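(* Let $b$ be a constant, and let $P$ be a finite set of distinct points and $L$ a finite set of distinct lines in $\mathbb{R}^3$ such that, for every point $p\in P$ and every plane $\pi$ through $p$, at most $b$ lines of $L$ pass through $p$ and lie in $\pi$. Then $$ I(P,L) = O\left(|P|^{1/2}|L|^{3/4}+|P|+|L|\right), $$ where the constant of proportionality depends on $b$.
   Context: $I(P,L)$ denotes the number of pairs $(p,\ell)\in P\times L$ with $p\in\ell$. *)

(* Defs.v *)
From HB Require Import structures.
From mathcomp Require Export all_boot all_order all_algebra finmap.
From mathcomp Require Export boolp classical_sets reals exp.

Set Implicit Arguments.
Unset Strict Implicit.
Unset Printing Implicit Defensive.

Import Order.TTheory GRing.Theory Num.Theory.
Local Open Scope ring_scope.
Local Open Scope classical_set_scope.

Definition flat (R : realType) (n k : nat) (X : set 'rV[R]_n) : Prop :=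
  exists (p : 'rV[R]_n) (A : 'M[R]_(k, n)),
    row_free A /\ X = [set p + x *m A | x in [set: 'rV[R]_k]].

Definition is_line (R : realType) (n : nat) (l : set 'rV[R]_n) : Prop :=
  flat 1 l.

Definition is_plane (R : realType) (n : nat) (pi : set 'rV[R]_n) : Prop :=
  flat 2 pi.

Definition incidences (R : realType) (n : nat)
    (P : {fset 'rV[R]_n}) (L : {fset set 'rV[R]_n}) : nat :=
  #|` [fset pl in (P `*` L)%fset | pl.1 \in pl.2]%fset |.

Definition lines_through_in (R : realType) (n : nat) (L : {fset set 'rV[R]_n})
    (p : 'rV[R]_n) (pi : set 'rV[R]_n) : {fset set 'rV[R]_n} :=
  [fset l in L | `[< l p /\ (l `<=` pi)%classic >]]%fset.

(* Main.v *)
(** Fix a degree scale D.  A polynomial F of degree O(D) cuts space into cells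
    such that at most O(|P|^2 / D^3) ordered pairs of points share a cell.  A
    line not contained in Z(F) meets O(D) cells, and two points lie on at most
    one common line, so the incidences off Z(F) number O(D|L| + |P|^2 / D^3);
    such a line also carries at most deg F points of Z(F).  For the lines inside
    Z(F), repeatedly delete lines with few points and points with at most b
    lines.  If this gets stuck, every remaining point has lines in three
    independent directions, so the gradient of any low degree polynomial
    vanishing on the remaining lines vanishes at the points, hence on the lines,
    and descent on the degree is absurd; thus these incidences number
    O(D|L| + b|P|).  Take D^4 = |P|^2 / |L|.

    The partition does not use the ham sandwich theorem.  After discarding a
    dense subspace of the Veronese vectors of the points (on which a polynomial
    can be made to vanish), the remaining vectors admit weights in nearly radial
    isotropic position; then two typical points of the same cell are almost
    orthogonal and a random polynomial separates them with positive
    probability, so each step shrinks the number of pairs sharing a cell by a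
    constant factor. *)

From HB Require Import structures.
Require Import Defs.
From mathcomp Require Import finmap boolp classical_sets reals exp.
From mathcomp Require Import all_boot all_order all_algebra.
From mathcomp Require Import polyrcf ring lra zify.
From mathcomp Require mpoly.
Import -(notations) mpoly.

Set Implicit Arguments.
Unset Strict Implicit.
Unset Printing Implicit Defensive.

Import Order.TTheory GRing.Theory Num.Theory.
Local Open Scope ring_scope.

(** * Rank one determinant updates and weighted Gram matrices *)

(** After [A] is factored out, the block matrix [B] has two triangular factorisations, with
    determinants those of [1 + c *m v] and of the scalar [1 + v *m c]. *)
Lemma det_rank1_update (F : fieldType) (n : nat) (A : 'M[F]_n) (s : F)
    (v : 'rV[F]_n) :
  A \in unitmx ->
  \det (A + s *: (v^T *m v)) = \det A * (1 + s * (v *m invmx A *m v^T) 0 0).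
Proof.
move=> uA.
have -> : A + s *: (v^T *m v) = A *m (1%:M + s *: (invmx A *m v^T) *m v).
  by rewrite mulmxDr mulmx1 -scalemxAl -scalemxAr !mulmxA mulmxV // mul1mx.
rewrite det_mulmx; congr (_ * _).
set c := s *: (invmx A *m v^T).
pose B : 'M[F]_(1 + n) := block_mx 1%:M (- v) c 1%:M.
have e1 : B = block_mx 1%:M 0 c 1%:M *m block_mx 1%:M (- v) 0 (1%:M + c *m v).
  rewrite mulmx_block !(mul1mx, mulmx1, mul0mx, mulmx0, addr0, mulmxN).
  by rewrite addrCA addNr addr0.
have e2 : B = block_mx (1%:M + v *m c) (- v) 0 1%:M *m block_mx 1%:M 0 c 1%:M.
  rewrite mulmx_block !(mul1mx, mulmx1, mul0mx, mulmx0, addr0, add0r, mulNmx).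
  by rewrite addrK.
have : \det B = \det B by [].
rewrite {1}e1 {1}e2 !det_mulmx !det_lblock !det_ublock !det1 !mul1r !mulr1.
move=> ->; rewrite det_mx11 mxE [X in X + _ = _]mxE eqxx /c -scalemxAr mulmxA.
by rewrite [X in _ + X = _]mxE.
Qed.

Section WeightedGram.
Variables (R : realFieldType) (I : finType) (n : nat).
Implicit Types (A S : {set I}) (v : I -> 'rV[R]_n) (w : I -> R).

Definition gram A v w : 'M[R]_n := \sum_(i in A) w i *: ((v i)^T *m v i).

Definition span A v : 'M[R]_n := (\sum_(i in A) <<v i>>)%MS.

Lemma gram_mul A v w m (U : 'M[R]_(m, n)) :
  U *m gram A v w = \sum_(i in A) w i *: ((U *m (v i)^T) *m v i).
Proof.
by rewrite mulmx_sumr; apply: eq_bigr => i _; rewrite -scalemxAr mulmxA.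
Qed.

Lemma mul11E (x y : 'M[R]_1) : (x *m y) 0 0 = x 0 0 * y 0 0.
Proof. by rewrite mxE big_ord1. Qed.

Lemma mul_rV_trC (u u' : 'rV[R]_n) : (u *m u'^T) 0 0 = (u' *m u^T) 0 0.
Proof.
have -> : u *m u'^T = (u' *m u^T)^T by rewrite trmx_mul trmxK.
by rewrite [LHS]mxE.
Qed.

Lemma gram_quad A v w (u u' : 'rV[R]_n) :
  (u *m gram A v w *m u'^T) 0 0 =
  \sum_(i in A) w i * ((u *m (v i)^T) 0 0 * (u' *m (v i)^T) 0 0).
Proof.
rewrite gram_mul mulmx_suml summxE; apply: eq_bigr => i _.
by rewrite -scalemxAl mxE -mulmxA mul11E [(v i *m _) _ _]mul_rV_trC.
Qed.

Lemma gram_sym A v w : (gram A v w)^T = gram A v w.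
Proof.
rewrite /gram raddf_sum; apply: eq_bigr => i _ /=.
by rewrite linearZ /= trmx_mul trmxK.
Qed.

(** A kernel vector [u] has zero quadratic form, a weighted sum of squares, so [u] is orthogonal to
    every [v i]; these span the space. *)
Lemma gram_unit A v w :
  (forall i, i \in A -> 0 < w i) -> (1%:M <= span A v)%MS ->
  gram A v w \in unitmx.
Proof.
move=> w0 sA; rewrite -row_free_unit -kermx_eq0; apply/negPn/negP => nz.
have /rowV0Pn[u uker u0] := nz.
have uG : u *m gram A v w = 0 by apply/sub_kermxP.
have q0 : \sum_(i in A) w i * ((u *m (v i)^T) 0 0) ^+ 2 = 0.
  have := gram_quad A v w u u; rewrite uG mul0mx mxE => e0.
  by rewrite [RHS]e0; apply: eq_bigr => i _; rewrite expr2.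
have z i : i \in A -> u *m (v i)^T = 0.
  move=> iA; move/eqP: q0; rewrite psumr_eq0 => [/allP q0|j jA]; last first.
    by rewrite mulr_ge0 ?sqr_ge0 // ltW // w0.
  have := q0 i (mem_index_enum _); rewrite iA /= mulf_eq0 (gt_eqF (w0 i iA)) /=.
  rewrite sqrf_eq0 => /eqP e; apply/matrixP => a b.
  by rewrite !ord1 e mxE.
have : (1%:M <= kermx u^T)%MS.
  apply: submx_trans sA _; apply/sumsmx_subP => i iA.
  rewrite genmxE; apply/sub_kermxP.
  by rewrite -[LHS]trmxK trmx_mul trmxK z // trmx0.
move/sub_kermxP; rewrite mul1mx => /(congr1 trmx); rewrite trmxK trmx0 => e.
by rewrite e eqxx in u0.
Qed.

(** The inner product of [v i] and [v j] once the weighted family is put in isotropic position;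
    [w i * lev A v w i i] is the leverage score of [i]. *)
Definition lev A v w (i j : I) : R :=
  (v i *m invmx (gram A v w) *m (v j)^T) 0 0.

Lemma lev_sym A v w i j : lev A v w i j = lev A v w j i.
Proof. by rewrite /lev mul_rV_trC trmx_mul trmx_inv gram_sym mulmxA. Qed.

(** With [G] the Gram matrix, this is the identity [G^-1 G G^-1 = G^-1] evaluated on two vectors. *)
Lemma lev_mul A v w i j : gram A v w \in unitmx ->
  \sum_(k in A) w k * (lev A v w k i * lev A v w k j) = lev A v w i j.
Proof.
move=> uG; set G := gram A v w in uG *.
have := gram_quad A v w (v i *m invmx G) (v j *m invmx G).
rewrite -/G trmx_mul trmx_inv gram_sym -/G !mulmxA mulmxKV // => e.
rewrite /lev -/G e; apply: eq_bigr => k _; congr (_ * _).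
by rewrite -!/(lev A v w _ _) !(lev_sym _ _ _ k).
Qed.

Lemma lev_ge0 A v w i : gram A v w \in unitmx -> 
  (forall i, i \in A -> 0 <= w i) -> 0 <= lev A v w i i.
Proof.
move=> uG w0; rewrite -lev_mul //; apply: sumr_ge0 => k kA.
by rewrite -expr2 mulr_ge0 ?sqr_ge0 ?w0.
Qed.

Lemma lev_trace A v w : gram A v w \in unitmx ->
  \sum_(i in A) w i * lev A v w i i = n%:R.
Proof.
rewrite /lev; set X := invmx _ => uG.
rewrite -[RHS](mxtrace1 R n) -(mulVmx uG) -/X.
rewrite /gram mulmx_sumr raddf_sum /=; apply: eq_bigr => i _.
rewrite -scalemxAr linearZ /=; congr (_ * _).
by rewrite mulmxA mxtrace_mulC mulmxA /mxtrace big_ord1.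
Qed.

End WeightedGram.

(** * Ranks of superlevel sets and weights with large leverage *)

Lemma sum_superlevels (I : finType) (A : {set I}) (k : I -> nat) K :
  (forall i, i \in A -> (k i <= K)%N) ->
  (\sum_(i in A) k i = \sum_(t < K) #|[set i in A | (t < k i)%N]|)%N.
Proof.
move=> kK; rewrite (eq_bigr (fun i => \sum_(t < K) (t < k i)%N)%N); last first.
  move=> i /kK kiK.
  rewrite -(big_mkord xpredT (fun t => nat_of_bool (t < k i)%N)).
  rewrite (big_cat_nat (leq0n _) kiK) /= (eq_big_nat _ _ (F2 := fun=> 1%N)).
    rewrite sum_nat_const_nat subn0 muln1 big_nat_cond big1 ?addn0 //.
    by move=> t /andP[/andP[h _] _]; rewrite ltnNge h.
  by move=> t /andP[_ ->].
rewrite exchange_big; apply: eq_bigr => t _.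
by rewrite -big_mkcondr sum1dep_card.
Qed.

Section Leverage.
Variables (R : realType) (I : finType) (n : nat) (v : I -> 'rV[R]_n).
Implicit Types (A B S T : {set I}) (k : I -> nat).

Definition srank S : nat := \rank (span S v).

Lemma span_sub S i : i \in S -> (v i <= span S v)%MS.
Proof. by move=> iS; apply: (sumsmx_sup i) => //; rewrite genmxE. Qed.

Lemma spanP S m (U : 'M[R]_(m, n)) :
  (forall i, i \in S -> (v i <= U)%MS) -> (span S v <= U)%MS.
Proof. by move=> h; apply/sumsmx_subP => i iS; rewrite genmxE h. Qed.

Lemma spanS S T : S \subset T -> (span S v <= span T v)%MS.
Proof. by move=> /subsetP sST; apply: spanP => i /sST /span_sub. Qed.

Lemma srankS S T : S \subset T -> (srank S <= srank T)%N.
Proof. by move=> /spanS /mxrankS. Qed.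

Lemma srank_card S : (srank S <= #|S|)%N.
Proof.
rewrite /srank /span -sum1_card.
elim/big_ind2: _ => [|m1 r1 m2 r2 h1 h2|i _]; first by rewrite mxrank0.
  by apply: leq_trans (mxrank_adds_leqif _ _) _; rewrite leq_add.
by rewrite mxrank_gen rank_leq_row.
Qed.

Lemma srank_setU1 S i : ~~ (v i <= span S v)%MS -> (srank S < srank (i |: S))%N.
Proof.
move=> ni; have sS : (span S v <= span (i |: S) v)%MS by apply/spanS/subsetUr.
rewrite ltn_neqAle mxrankS // andbT; apply: contra ni => e.
have := mxrank_leqif_sup sS; case=> _; rewrite e => /esym h.
by apply: submx_trans h; apply: span_sub; rewrite setU11.
Qed.

Lemma extend_independent B S : B \subset S -> srank B = #|B| ->
  exists B', [/\ B \subset B', B' \subset S, srank B' = #|B'|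
               & srank B' = srank S].
Proof.
move=> sBS iB.
pose P (X : {set I}) := [&& B \subset X, X \subset S & srank X == #|X|].
have PB : P B by rewrite /P subxx sBS iB eqxx.
case: (arg_maxnP (fun X : {set I} => #|X|) PB) => X /and3P[BX XS /eqP iX] maxX.
exists X; split=> //; apply/eqP; rewrite eqn_leq srankS //=.
apply: mxrankS; apply: spanP => i iS; apply/negPn/negP => ni.
have lt := srank_setU1 ni.
have iNX : i \notin X by apply: contra ni; apply: span_sub.
have := maxX (i |: X); rewrite /P (subset_trans BX (subsetUr _ _)) /=.
rewrite subUset sub1set iS XS cardsU1 iNX /= add1n.
rewrite eqn_leq -{2}iX lt andbT.
have := srank_card (i |: X); rewrite cardsU1 iNX add1n => -> /(_ isT).
by rewrite ltnn.
Qed.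

(** An independent set is grown from the top level downwards, so that it contains a basis of each
    superlevel set; counting its elements layer by layer gives the inequality. *)
Lemma greedy_basis A k K : (forall i, i \in A -> (k i <= K)%N) ->
  exists B, [/\ B \subset A, srank B = #|B|, srank B = srank A
    & (\sum_(t < K) srank [set i in A | (t < k i)%N] <= \sum_(i in B) k i)%N].
Proof.
move=> kK; pose At (t : nat) := [set i in A | (t <= k i)%N].
have AtS s t : (s <= t)%N -> At t \subset At s.
  move=> st; apply/subsetP => i; rewrite !inE => /andP[-> ti].
  exact: leq_trans ti.
have step j : (j <= K)%N -> exists B, [/\ B \subset At (K - j)%N, 
    srank B = #|B|, srank B = srank (At (K - j)%N)
    & forall t, (K - j <= t <= K)%N -> (srank (At t) <= #|B :&: At t|)%N].
  elim: j => [_|j IH jK].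
    have s0 : srank set0 = #|(set0 : {set I})|.
      by apply/eqP; rewrite cards0 -leqn0 -(cards0 I) srank_card.
    have [B [_ BA iB rB]] := extend_independent (sub0set (At (K - 0)%N)) s0.
    exists B; split=> // t; rewrite subn0 -eqn_leq => /eqP <-.
    by rewrite -[in At K](subn0 K) -rB iB (setIidPl BA).
  have [B [BA iB rB hB]] := IH (ltnW jK).
  have sub : B \subset At (K - j.+1)%N.
    by apply: subset_trans BA (AtS _ _ _); lia.
  have [B' [BB' BA' iB' rB']] := extend_independent sub iB.
  exists B'; split=> // t /andP[t1 t2].
  have [tj|] := leqP (K - j)%N t.
    by apply: leq_trans (hB t _) (subset_leq_card (setSI _ BB')); rewrite tj.
  move=> tj; have -> : t = (K - j.+1)%N by lia.
  by rewrite -rB' iB' (setIidPl BA').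
have [B [BA iB rB hB]] := step K (leqnn K).
have A0 : At (K - K)%N = A by apply/setP => i; rewrite inE subnn andbT.
rewrite A0 in BA rB; exists B; split=> //.
rewrite (@sum_superlevels _ B k K) => [|i /(subsetP BA) /kK //].
apply: leq_sum => t _.
(* The strict superlevel set at [t] is [At t.+1]. *)
have := hB t.+1; rewrite subnn leq0n ltn_ord => /(_ isT) h.
apply: leq_trans h (subset_leq_card _); apply/subsetP => i.
by rewrite !inE => /and3P[-> _ ->].
Qed.

Local Notation lv A w i := (w i * lev A v w i i).

Lemma full_srank A : (1%:M <= span A v)%MS -> srank A = n.
Proof. by move=> h; apply/eqP; rewrite -[_ == _]/(row_full _) -sub1mx. Qed.

Lemma srank_full A : srank A = n -> (1%:M <= span A v)%MS.
Proof. by move=> h; rewrite sub1mx; apply/eqP. Qed.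

Lemma det_gram_scale A (w w' : I -> R) (c : R) i : i \in A ->
  gram A v w \in unitmx -> w' i = c * w i ->
  (forall j, j \in A -> j != i -> w' j = w j) ->
  \det (gram A v w') = \det (gram A v w) * (1 + (c - 1) * lv A w i).
Proof.
move=> iA uG wi wj.
have -> : gram A v w' = gram A v w + ((c - 1) * w i) *: ((v i)^T *m v i).
  rewrite /gram (bigD1 i) //= [in RHS](bigD1 i) //= wi addrAC -scalerDl.
  congr (_ *: _ + _); first by ring.
  by apply: eq_bigr => j /andP[jA ji]; rewrite wj.
by rewrite det_rank1_update // mulrA.
Qed.

(** In [lev_mul] taken at [i, i], the term [k = i] alone gives [t * t <= t] for the score [t]. *)
Lemma lev_le1 A (w : I -> R) i : (forall j, j \in A -> 0 < w j) ->
  gram A v w \in unitmx -> i \in A -> lv A w i <= 1.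
Proof.
move=> w0 uG iA; set t := lv A w i.
have t0 : 0 <= t.
  by rewrite mulr_ge0 ?lev_ge0 ?ltW ?w0 // => j /w0 /ltW.
suff : t * t <= t by move=> h; rewrite leNgt; apply/negP => lt1; nra.
rewrite {3}/t -lev_mul // (bigD1 i) //= mulrDr /t -[leLHS]addr0 lerD //.
  by rewrite le_eqVlt; apply/orP; left; apply/eqP; ring.
rewrite mulr_ge0 ?(ltW (w0 _ iA)) // sumr_ge0 // => j /andP[jA _].
by rewrite -expr2 mulr_ge0 ?sqr_ge0 // ltW // w0.
Qed.

(** By the trace formula the [n] scores sum to [n], and none exceeds one. *)
Lemma lev_basis B (w : I -> R) i : (forall j, j \in B -> 0 < w j) ->
  gram B v w \in unitmx -> #|B| = n -> i \in B -> lv B w i = 1.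
Proof.
move=> w0 uG cB iB.
have /eqP : \sum_(j in B) (1 - lv B w j) = 0.
  rewrite big_split /= sumrN lev_trace // sumr_const cB subrr //.
rewrite psumr_eq0 => [/allP/(_ i (mem_index_enum _))|j jB].
  by rewrite iB /= subr_eq0 => /eqP.
by rewrite subr_ge0 lev_le1.
Qed.

Lemma gram_eq A (w w' : I -> R) : (forall i, i \in A -> w i = w' i) ->
  gram A v w = gram A v w'.
Proof. by move=> h; apply: eq_bigr => i iA; rewrite h. Qed.

(** Powers of four have the explicit square roots [2 ^+ k i], which later scale the random sign
    vectors. *)
Definition pw4 k : I -> R := fun i => 4 ^+ k i.

Lemma pw4_gt0 k i : 0 < pw4 k i.
Proof. by rewrite exprn_gt0. Qed.
#[local] Hint Resolve pw4_gt0 : core.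

Lemma pw4_unit A k : (1%:M <= span A v)%MS -> gram A v (pw4 k) \in unitmx.
Proof. by move=> h; apply: gram_unit. Qed.

(** Raising one exponent multiplies the determinant by [1 + (4 - 1) * 1 = 4], since scores on a
    basis equal one. *)
Lemma det_basis B k : (1%:M <= span B v)%MS -> #|B| = n ->
  \det (gram B v (pw4 k)) =
  4 ^+ (\sum_(i in B) k i) * \det (gram B v (fun=> 1)).
Proof.
move=> sB cB; move: {2}(\sum_(i in B) k i)%N (erefl (\sum_(i in B) k i)%N) => N.
elim: N k => [|N IH] k.
  move/eqP; rewrite sum_nat_eq0 => /forall_inP k0.
  rewrite big1 => [|i /k0 /eqP //]; rewrite expr0 mul1r; congr (\det _).
  by apply: gram_eq => i /k0 /eqP e; rewrite /pw4 e.
move=> e; have [i iB ki] : exists2 i, i \in B & (0 < k i)%N.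
  apply/exists_inP; rewrite -[[exists _ in _, _]]negbK.
  rewrite negb_exists_in; apply/negP => /forall_inP h.
  by move: e; rewrite big1 // => i /h; rewrite -eqn0Ngt => /eqP.
pose k' j := if j == i then (k i).-1 else k j.
have e' : (\sum_(j in B) k' j = N)%N.
  move: e; rewrite (bigD1 i) //= [in X in _ -> X](bigD1 i) //= /k' eqxx.
  rewrite [X in (_ + X)%N = N](eq_bigr k); last by move=> j /andP[_ /negPf ->].
  by move: ki; lia.
have uG := pw4_unit k' sB.
rewrite (@det_gram_scale B (pw4 k') (pw4 k) 4 i) //; last 2 first.
- by rewrite /pw4 /k' eqxx -exprS prednK.
- by move=> j jB /negPf ji; rewrite /pw4 /k' ji.
rewrite lev_basis // IH // e e' exprS; ring.
Qed.

Lemma det_gramS A B (w : I -> R) : (forall i, 0 < w i) ->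
  (1%:M <= span B v)%MS -> B \subset A ->
  `|\det (gram B v w)| <= `|\det (gram A v w)|.
Proof.
move=> w0 sB; move: {2}#|A :\: B| (erefl #|A :\: B|) => N.
elim: N A => [|N IH] A.
  move/eqP; rewrite cards_eq0 setD_eq0 => sAB sBA.
  by rewrite (_ : A = B) //; apply/eqP; rewrite eqEsubset sAB.
move=> cAB sBA; have /card_gt0P [i] : (0 < #|A :\: B|)%N by rewrite cAB.
rewrite inE => /andP[iNB iA].
have sB' : B \subset A :\ i by rewrite subsetD1 sBA.
apply: le_trans (IH (A :\ i) _ sB') _.
  have -> : (A :\ i) :\: B = (A :\: B) :\ i.
    by apply/setP => j; rewrite !inE andbCA.
  by apply/eqP; rewrite -eqSS -cAB (cardsD1 i (A :\: B)) inE iNB iA.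
have fA : (1%:M <= span (A :\ i) v)%MS by apply: submx_trans sB (spanS _).
have uG : gram (A :\ i) v w \in unitmx by apply: gram_unit.
have -> : gram A v w = gram (A :\ i) v w + w i *: ((v i)^T *m v i).
  rewrite /gram (bigD1 i) //= addrC; congr (_ + _).
  by apply: eq_bigl => j; rewrite !inE andbC.
rewrite det_rank1_update // normrM ler_peMr //.
have h : 0 <= (v i *m invmx (gram (A :\ i) v w) *m (v i)^T) 0 0.
  by apply: lev_ge0 => // j _; apply: ltW.
by rewrite ger0_norm ?lerDl ?addr_ge0 ?mulr_ge0 ?(ltW (w0 i)).
Qed.

(** Induction on [M]: [(1 + x) * (1 - (M + 1) * x) <= 1 - M * x]. Positive [x] serves the leverage
    bound, negative [x] the geometric decay. *)
Lemma bernoulli_inv (x : R) M : -1 <= x -> (1 + x) ^+ M * (1 - M%:R * x) <= 1.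
Proof.
move=> x0; elim: M => [|M IH]; first by rewrite mul0r subr0 mulr1.
apply: le_trans IH; rewrite exprSr -mulrA.
rewrite ler_wpM2l ?exprn_ge0 -?lerBlDl ?sub0r //.
rewrite -[M.+1]addn1 natrD.
have := mulr_ge0 (ler0n R M) (sqr_ge0 x); have := sqr_ge0 x; nra.
Qed.

(* The minimiser of |det gram|^M / 4^(sum k) cannot reach the top level: a
   basis adapted to the superlevel sets of k bounds the determinant from below
   by 4^(sum of their ranks), and the rank hypothesis makes this beat the
   denominator. *)
Lemma leverage_weights A M : (1%:M <= span A v)%MS ->
  (forall S, S \subset A -> S != set0 -> (#|S| < M * srank S)%N) ->
  exists k : I -> nat, forall i, i \in A ->
    1 <= (4 * M)%:R * lv A (pw4 k) i.
Proof.
move=> sA hM.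
pose D w := `|\det (gram A v w)|.
pose d0 B := `|\det (gram B v (fun=> 1))|.
(* [4 ^+ C] dominates the ratio [d0 A / d0 B] for every spanning [B]. The level [K] exceeds [M * C]
   by one, which is the final contradiction when some [k i] reaches [K]. *)
pose C := (\sum_(B : {set I}) Num.bound (d0 A / d0 B))%N.
pose K := (M * C).+1.
pose kf (f : {ffun I -> 'I_K.+1}) : I -> nat := fun i => f i.
pose F f := D (pw4 (kf f)) ^+ M / 4 ^+ (\sum_(i in A) kf f i).
have D_gt0 k : 0 < D (pw4 k).
  by rewrite normr_gt0 -unitfE -unitmxE pw4_unit.
have d0_gt0 B : (1%:M <= span B v)%MS -> 0 < d0 B.
  by move=> sB; rewrite normr_gt0 -unitfE -unitmxE gram_unit.
pose f0 : {ffun I -> 'I_K.+1} := [ffun => ord0].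
case: (arg_minP F (erefl : xpredT f0)) => f _ fmin.
have fK i : i \in A -> (kf f i < K)%N.
  move=> iA; rewrite ltn_neqAle -ltnS ltn_ord andbT; apply/negP => /eqP fi.
  have [|B [BA iB rB hB]] := @greedy_basis A (kf f) K.
    by move=> j _; rewrite -ltnS ltn_ord.
  have rBn : srank B = n by rewrite rB full_srank.
  have sB := srank_full rBn.
  have cB : #|B| = n by rewrite -iB.
  have low : d0 A * 4 ^+ (\sum_(j in B) kf f j) <= 4 ^+ C * D (pw4 (kf f)).
    have -> : d0 A = d0 A / d0 B * d0 B by rewrite divfK // gt_eqF // d0_gt0.
    apply: le_trans (_ : 4 ^+ C * d0 B * 4 ^+ (\sum_(j in B) kf f j) <= _).
      rewrite ler_pM2r ?exprn_gt0 // ler_pM2r ?d0_gt0 //.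
      apply: le_trans (ltW (archi_boundP _)) _.
        by rewrite divr_ge0 ?normr_ge0.
      apply: le_trans (_ : C%:R <= _).
        by rewrite ler_nat /C (bigD1 B) //= leq_addr.
      rewrite -natrX ler_nat ltnW // ltn_expl //.
    rewrite -mulrA ler_pM2l ?exprn_gt0 //.
    apply: le_trans (det_gramS _ sB BA) => //.
    by rewrite det_basis // normrM ger0_norm ?exprn_ge0 // mulrC.
  have up : D (pw4 (kf f)) ^+ M <= d0 A ^+ M * 4 ^+ (\sum_(j in A) kf f j).
    have := fmin f0 isT; rewrite /F ler_pdivrMr ?exprn_gt0 //.
    have e0 : pw4 (kf f0) = (fun=> 1).
      by apply/funext => j; rewrite /pw4 /kf ffunE expr0.
    rewrite e0 big1 ?expr0 ?divr1 // => j _.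
    by rewrite /kf ffunE.
  have big : (M * \sum_(j in B) kf f j <= M * C + \sum_(j in A) kf f j)%N.
    have := lerXn2r M _ _ low.
    rewrite !nnegrE !mulr_ge0 ?normr_ge0 ?exprn_ge0 // => /(_ isT isT).
    rewrite !exprMn => h.
    have {}h := le_trans h (ler_wpM2l (exprn_ge0 M (exprn_ge0 C _)) up).
    move: (h (ler0n _ 4)); rewrite mulrCA ler_pM2l ?exprn_gt0 ?d0_gt0 //.
    rewrite -!exprM -exprD ler_eXn2l ?ltr1n // => {}h.
    by rewrite mulnC (mulnC M C).
  have sumA : (\sum_(j in A) kf f j =
               \sum_(t < K) #|[set j in A | (t < kf f j)%N]|)%N.
    by apply: sum_superlevels => j _; rewrite -ltnS ltn_ord.
  have : (\sum_(t < K) #|[set j in A | (t < kf f j)%N]| + K <=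
          \sum_(t < K) M * srank [set j in A | (t < kf f j)%N])%N.
    rewrite -[X in (_ + X <= _)%N]card_ord -sum1_card -big_split /=.
    apply: leq_sum => t _; rewrite addn1; apply: hM.
      by apply/subsetP => j; rewrite inE => /andP[].
    by apply/set0Pn; exists i; rewrite inE iA fi ltn_ord.
  rewrite -sumA -big_distrr /= => h.
  have := leq_trans h (leq_mul (leqnn M) hB) => {}h.
  by have := leq_trans h big; rewrite /K; lia.
exists (kf f) => i iA; set t := lv A _ i.
have uG := pw4_unit (kf f) sA.
have t0 : 0 <= t.
  by apply: mulr_ge0; [exact: ltW | apply: lev_ge0 => // j _; exact: ltW].
(* Raising [k i] by one stays in range by [fK] and multiplies the functional by
   [(1 + 3 * t) ^+ M / 4]. Minimality makes this at least one, and the Bernoulli bound then yields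
   [4 * M * t >= 1]. *)
pose f1 : {ffun I -> 'I_K.+1} :=
  [ffun j => if j == i then inord (f i).+1 else f j].
have f1i : kf f1 i = (kf f i).+1.
  by rewrite /kf ffunE eqxx inordK // ltnS fK.
have f1j j : j != i -> kf f1 j = kf f j by rewrite /kf ffunE => /negPf ->.
have : F f <= F f1 by apply: fmin.
have -> : F f1 = F f * ((1 + 3 * t) ^+ M / 4).
  rewrite /F /D (@det_gram_scale A (pw4 (kf f)) (pw4 (kf f1)) 4 i) //;
    last 2 first.
  - by rewrite /pw4 f1i exprS.
  - by move=> j _ ji; rewrite /pw4 f1j.
  have -> : (4 - 1 : R) = 3 by lra.
  rewrite -/t normrM (ger0_norm (_ : 0 <= 1 + 3 * t)); last by lra.
  rewrite exprMn (bigD1 i) //= f1i [X in _ = _ / 4 ^+ X * _](bigD1 i) //=.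
  rewrite (eq_bigr (kf f)); last by move=> j /andP[_ ji]; rewrite f1j.
  by rewrite addSn exprS invfM (mulrC 4^-1) mulrACA.
rewrite ler_pMr ?divr_gt0 ?exprn_gt0 //.
rewrite ler_pdivlMr // mul1r => h.
rewrite leNgt; apply/negP; rewrite natrM => lt1.
have := @bernoulli_inv (3 * t) M (_ : -1 <= 3 * t).
rewrite (_ : -1 <= 3 * t); last by lra.
move=> /(_ isT).
have : 1 / 4 < 1 - M%:R * (3 * t) by lra.
move: h; move: ((1 + 3 * t) ^+ M) (1 - M%:R * (3 * t)) => X Y; nra.
Qed.

End Leverage.

(** * Random signs and the separation of nearly orthogonal vectors *)

Section SignAverage.
Variables (R : realFieldType) (n : nat).
Implicit Types (s : seq 'cV[R]_n) (x g : 'cV[R]_n) (F G : 'cV[R]_n -> R).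

(* The expectation of F (x + sum of eps_a *: a) over independent signs. *)
Fixpoint sign_avg s F x : R :=
  if s is a :: s' then (sign_avg s' F (x + a) + sign_avg s' F (x - a)) / 2
  else F x.

Lemma sign_avg_le_val s F x : exists g, sign_avg s F x <= F g.
Proof.
elim: s x => [|a s IH] x; first by exists x.
have [g1 h1] := IH (x + a); have [g2 h2] := IH (x - a) => /=.
by have [h|h] := leP (F g1) (F g2); [exists g2 | exists g1]; lra.
Qed.

Lemma sign_avg_cst s (c : R) x : sign_avg s (fun=> c) x = c.
Proof. by elim: s x => //= a s IH x; rewrite !IH; lra. Qed.

Lemma sign_avgD s F G x :
  sign_avg s (fun g => F g + G g) x = sign_avg s F x + sign_avg s G x.
Proof. by elim: s x => //= a s IH x; rewrite !IH; lra. Qed.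

Lemma sign_avgZ s (c : R) F x :
  sign_avg s (fun g => c * F g) x = c * sign_avg s F x.
Proof. by elim: s x => //= a s IH x; rewrite !IH; lra. Qed.

Lemma sign_avg_sum s (J : finType) (P : pred J) (F : J -> 'cV[R]_n -> R) x :
  sign_avg s (fun g => \sum_(j | P j) F j g) x =
  \sum_(j | P j) sign_avg s (F j) x.
Proof.
elim: s x => //= a s IH x; rewrite !IH -big_split mulr_suml.
by apply: eq_bigr.
Qed.

Definition pairing (u : 'rV[R]_n) g : R := (u *m g) 0 0.

Lemma pairingD u x g : pairing u (x + g) = pairing u x + pairing u g.
Proof. by rewrite /pairing mulmxDr mxE. Qed.

Lemma pairingB u x g : pairing u (x - g) = pairing u x - pairing u g.
Proof. by rewrite /pairing mulmxBr !mxE. Qed.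

Lemma pairing0 u : pairing u 0 = 0.
Proof. by rewrite /pairing mulmx0 mxE. Qed.

Lemma pairingZl (c : R) u g : pairing (c *: u) g = c * pairing u g.
Proof. by rewrite /pairing -scalemxAl mxE. Qed.

Lemma pairingZr (c : R) u g : pairing u (c *: g) = c * pairing u g.
Proof. by rewrite /pairing -scalemxAr mxE. Qed.

Lemma sign_avg_mul s (u u' : 'rV[R]_n) x :
  sign_avg s (fun g => pairing u g * pairing u' g) x =
  pairing u x * pairing u' x + \sum_(a <- s) pairing u a * pairing u' a.
Proof.
elim: s x => [|a s IH] x /=; first by rewrite big_nil addr0.
by rewrite !IH big_cons !pairingB !pairingD; lra.
Qed.

(** A Khintchine type fourth moment bound; each new sign vector leaves a slack of [2 * z ^+ 4], with
    [z] its pairing with [u]. *)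
Lemma sign_avg_pow4 s (u : 'rV[R]_n) x :
  let v := \sum_(a <- s) pairing u a * pairing u a in
  sign_avg s (fun g => pairing u g ^+ 4) x <=
  pairing u x ^+ 4 + 6 * pairing u x ^+ 2 * v + 3 * v ^+ 2.
Proof.
elim: s x => [|a s IH] x /=; first by rewrite big_nil; lra.
have := IH (x + a); have := IH (x - a) => /=.
rewrite big_cons !pairingB !pairingD.
move: (\sum_(j <- s) _) (pairing u x) (pairing u a) => w y z h1 h2.
have z4 : 0 <= z ^+ 4 by rewrite (exprM z 2 2) sqr_ge0.
rewrite ler_pdivrMr //; apply: le_trans (lerD h2 h1) _.
rewrite -subr_ge0; apply: le_trans (_ : 4 * z ^+ 4 <= _); first by lra.
by rewrite le_eqVlt; apply/orP; left; apply/eqP; ring.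
Qed.

(** An even polynomial minorant of the absolute value, whose average is controlled by second and
    fourth moments. *)
Lemma le_norm_quartic (y : R) : y ^+ 2 - y ^+ 4 / 6 <= `|y|.
Proof.
have -> : y ^+ 2 = `|y| ^+ 2 by rewrite real_normK ?num_real.
have -> : y ^+ 4 = `|y| ^+ 4 by rewrite !(exprM _ 2 2) real_normK ?num_real.
move: `|y| (normr_ge0 y) => z z0.
suff h : 0 <= z ^+ 3 - 6 * z + 6 by nra.
have [z3|z3] := leP 3 z; first by nra.
(* [7/5] approximates the minimiser [sqrt 2] of the cubic; the product below differs from the cubic
   by a linear term of the right sign for [z < 3]. *)
have := mulr_ge0 (sqr_ge0 (z - 7/5)) (_ : 0 <= z + 14/5); nra.
Qed.

(** For opposite signs the claim is [2 * |y z| <= 48 + (y^4 + z^4) / 96], by the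
    arithmetic-geometric mean inequality applied twice. *)
Lemma norm_mul_le_opp (y z : R) :
  `|y| * `|z| <= y * z + 48 * (y * z < 0)%R%:R + (y ^+ 4 + z ^+ 4) / 96.
Proof.
have q : 0 <= (y ^+ 4 + z ^+ 4) / 96.
  by rewrite divr_ge0 // addr_ge0 // (exprM _ 2 2) sqr_ge0.
rewrite -normrM; have [h|h] := ltP (y * z) 0.
  rewrite ltr0_norm // mulr1.
  have a := sqr_ge0 (y ^+ 2 - z ^+ 2); have b := sqr_ge0 (y * z + 48); nra.
by rewrite ger0_norm // mulr0 addr0 lerDl.
Qed.

(** The kernel [same] is tested on [|Y p| - 1/2]. Its positivity bounds a polynomial in the [Y p] by
    the number of opposite pairs, and the average of that polynomial is large because the
    correlations [kap] are small in mean square. *)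
Lemma sign_split (I : finType) (A : {set I}) (same : rel I)
    (u : I -> 'rV[R]_n) s :
  let kap p q := \sum_(a <- s) pairing (u p) a * pairing (u q) a in
  let E := \sum_(p in A) \sum_(q in A) (same p q)%:R in
  (forall y : I -> R, 0 <= \sum_p \sum_q (same p q)%:R * (y p * y q)) ->
  (forall p, p \in A -> kap p p = 1) ->
  256 * \sum_(p in A) \sum_(q in A) kap p q ^+ 2 <= E ->
  exists g, E <= 384 * \sum_(p in A) \sum_(q in A)
     (same p q && (pairing (u p) g * pairing (u q) g < 0)%R)%:R.
Proof.
move=> kap E psd kap1 kapE.
pose Y p g := pairing (u p) g.
(* [T] is what the two absolute value estimates leave of the tested kernel; [3 / 32] is
   [1 / 96 + 1 / 12]. Its average is at least [1 - 6 * (3 / 32) - 1 / 4 - kap p q = 3 / 16 - kap p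
   q]. *)
pose T p q g := 1 / 2 * (Y p g * Y p g) + 1 / 2 * (Y q g * Y q g) +
  (-1) * (Y p g * Y q g) + (- (3 / 32)) * Y p g ^+ 4 + (- (3 / 32)) * Y q g ^+ 4
  + (- (1 / 4)).
pose Q g := \sum_(p in A) \sum_(q in A) (same p q)%:R * T p q g.
have [g Qg] := sign_avg_le_val s Q 0; exists g.
have avgT p q : p \in A -> q \in A -> 3 / 16 - kap p q <= sign_avg s (T p q) 0.
  move=> pA qA; rewrite /T !sign_avgD !sign_avgZ !sign_avg_mul sign_avg_cst.
  have := sign_avg_pow4 s (u p) 0; have := sign_avg_pow4 s (u q) 0.
  rewrite /= -!/(kap _ _) !kap1 // !pairing0 /Y; lra.
have avgQ : E / 8 <= sign_avg s Q 0.
  rewrite sign_avg_sum.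
  (* The linear term in [kap] is absorbed by [8 * (kap p q - 1 / 16) ^+ 2 >= 0], which lowers
     [3 / 16] to [5 / 32]; the squares then cost at most [E / 32]. *)
  apply: le_trans (_ : \sum_(p in A) \sum_(q in A)
     (5 / 32 * (same p q)%:R - 8 * kap p q ^+ 2) <= _).
    rewrite [leRHS](_ : _ =
      5 / 32 * E - 8 * (\sum_(p in A) \sum_(q in A) kap p q ^+ 2)).
      by lra.
    rewrite /E !mulr_sumr -sumrB; apply: eq_bigr => p _.
    by rewrite !mulr_sumr -sumrB.
  apply: ler_sum => p pA; rewrite sign_avg_sum; apply: ler_sum => q qA.
  rewrite sign_avgZ; case: (same p q); rewrite ?mul1r ?mul0r ?mulr1 ?mulr0.
    apply: le_trans (avgT p q pA qA).
    by have := sqr_ge0 (kap p q - 1 / 16); nra.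
  by have := sqr_ge0 (kap p q); lra.
have key : Q g <= 48 * \sum_(p in A) \sum_(q in A)
     (same p q && (pairing (u p) g * pairing (u q) g < 0)%R)%:R.
  pose y p : R := if p \in A then `|Y p g| - 1 / 2 else 0.
  have := psd y.
  have -> : \sum_p \sum_q (same p q)%:R * (y p * y q) =
      \sum_(p in A) \sum_(q in A)
        (same p q)%:R * ((`|Y p g| - 1/2) * (`|Y q g| - 1/2)).
    rewrite [RHS]big_mkcond; apply: eq_bigr => p _; rewrite /y.
    case: (p \in A); last by apply: big1 => q _; rewrite mul0r mulr0.
    rewrite [RHS]big_mkcond; apply: eq_bigr => q _.
    by case: (q \in A); rewrite ?mulr0.
  move=> h; rewrite -subr_ge0; apply: le_trans h _; rewrite mulr_sumr /Q -sumrB.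
  apply: ler_sum => p _; rewrite mulr_sumr -sumrB; apply: ler_sum => q _.
  case: (same p q); rewrite /= ?mul0r ?mulr0 ?subrr // !mul1r.
  have := norm_mul_le_opp (Y p g) (Y q g).
  have := le_norm_quartic (Y p g); have := le_norm_quartic (Y q g).
  rewrite /T -/(Y p g) -/(Y q g); lra.
lra.
Qed.

End SignAverage.

(** * Splitting a family of vectors by a hyperplane *)

Lemma pairing_comp (R : realFieldType) n r (x : 'rV[R]_n) (C : 'M[R]_(n, r))
    (g : 'cV[R]_r) : pairing x (C *m g) = pairing (x *m C) g.
Proof. by rewrite /pairing mulmxA. Qed.

Section VectorSplit.
Variables (R : realType) (I : finType) (d : nat) (v : I -> 'rV[R]_d).
Variable same : rel I.
Hypothesis psd :
  forall y : I -> R, 0 <= \sum_p \sum_q (same p q)%:R * (y p * y q).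

Let E : R := \sum_p \sum_q (same p q)%:R.

(** [T] is a largest set with at least [M] vectors per dimension of its span, and [C] is the
    quotient by that span. A nonempty [S] outside [T] violating the last bound could be added to
    [T]. *)
Lemma dense_quotient M : (#|I| < M * d)%N -> srank v setT = d ->
  exists (A : {set I}) (r : nat) (C : 'M[R]_(d, r)),
    [/\ (0 < r <= d)%N, row_full C, forall p, p \notin A -> v p *m C = 0,
        (1%:M <= span A (fun p => v p *m C))%MS &
        forall S : {set I}, S \subset A -> S != set0 ->
          (#|S| < M * srank (fun p => v p *m C) S)%N].
Proof.
move=> Id rT.
pose P (T : {set I}) := (M * srank v T <= #|T|)%N.
have P0 : P set0.
  have : (srank v set0 <= 0)%N by rewrite -(cards0 I) srank_card.
  by rewrite /P leqn0 => /eqP ->; rewrite muln0.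
case: (arg_maxnP (fun X : {set I} => #|X|) P0) => T PT maxT.
pose r := \rank (cokermx (span T v)).
have rE : r = (d - srank v T)%N by rewrite /r mxrank_coker.
have rTd : (srank v T < d)%N.
  have : (M * srank v T < M * d)%N.
    by apply: leq_ltn_trans Id; apply: leq_trans PT (max_card _).
  by rewrite ltn_mul2l => /andP[].
pose C := col_base (cokermx (span T v)).
have fC : row_full C by apply: col_base_full.
have kC p : p \in T -> v p *m C = 0.
  move=> pT; have : (v p <= span T v)%MS by apply: span_sub.
  have CE : C *m row_base (cokermx (span T v)) = cokermx (span T v).
    exact: mulmx_base.
  rewrite submxE => /eqP h.
  have {}h : v p *m C *m row_base (cokermx (span T v)) = 0.
    by rewrite -mulmxA CE.
  apply: (row_free_inj (row_base_free (cokermx (span T v)))).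
  by rewrite h mul0mx.
have rk S : (srank v (S :|: T) <= srank (fun p => v p *m C) S + srank v T)%N.
  rewrite /srank -(mxrank_mul_ker (span (S :|: T) v) C) leq_add //.
    rewrite /span sumsmxMr_gen; apply: mxrankS; apply/sumsmx_subP => i.
    rewrite genmxE.
    rewrite inE => iST; case: (boolP (i \in T)) => [iT|iT].
      have /eqmxMr e : (<<v i>> :=: v i)%MS := genmxE _.
      by rewrite e kC ?sub0mx.
    move: iST; rewrite (negPf iT) orbF => iS.
    have /eqmxMr e : (<<v i>> :=: v i)%MS := genmxE _.
    by rewrite e (sumsmx_sup i) // genmxE.
  apply: leq_trans (mxrankS (capmxSr _ _)) _.
  rewrite mxrank_ker (eqP fC : \rank C = _) -/r rE subKn //.
  exact: ltnW.
exists (~: T), r, C; split=> //.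
- by rewrite rE subn_gt0 rTd leq_subr.
- by move=> p; rewrite inE negbK => /kC.
- apply: srank_full; apply/eqP; rewrite eqn_leq rank_leq_col /=.
  have := rk (~: T); rewrite setUC setUCr rT.
  by move: rE; move: (srank _ (~: T)) => x; lia.
- move=> S SA S0; have ST : [disjoint S & T].
    by rewrite -[T]setCK -subsets_disjoint.
  have c : #|S :|: T| = (#|S| + #|T|)%N.
    by apply/eqP; rewrite (leq_card_setU S T).
  have Sp : (0 < #|S|)%N by rewrite card_gt0.
  have : ~~ P (S :|: T).
    by apply/negP => /maxT; rewrite c; lia.
  rewrite /P -ltnNge c => lt.
  rewrite -(ltn_add2r #|T|).
  apply: leq_trans (leq_trans lt (leq_mul (leqnn M) (rk S))) _.
  by rewrite mulnDr leq_add2l.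
Qed.

(** The leverage weights supply a random vector of covariance [G^-1]. For the normalised [u p], the
    squared correlations are at most [(4 * M)^2 w_p w_q K_pq^2], whose sum is [(4 * M)^2 * r] by the
    trace formula; hence [256 * 16 = 2 ^ 12]. *)
Lemma quotient_split M (A : {set I}) r (u : I -> 'rV[R]_r) :
  (1%:M <= span A u)%MS ->
  (forall S : {set I}, S \subset A -> S != set0 -> (#|S| < M * srank u S)%N) ->
  let E' : R := \sum_(p in A) \sum_(q in A) (same p q)%:R in
  (2 ^ 12 * M ^ 2 * r)%:R <= E' ->
  exists g, E' <= 384 * \sum_(p in A) \sum_(q in A)
     (same p q && (pairing (u p) g * pairing (u q) g < 0)%R)%:R.
Proof.
move=> sA hM E' hE'.
have [k hk] := leverage_weights sA hM.
set w := pw4 R k in hk.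
have w0 i : 0 < w i by exact: pw4_gt0.
have uG : gram A u w \in unitmx by apply: gram_unit.
set K := lev A u w in hk.
have K0 p : p \in A -> 0 < K p p.
  move=> pA; have := hk p pA; rewrite lt_neqAle lev_ge0 ?andbT.
  - by apply: contraTneq => <-; rewrite !mulr0 ler10.
  - by [].
  - by move=> i _; apply: ltW.
pose c p := (Num.sqrt (K p p))^-1.
have c0 p : p \in A -> 0 < c p by move=> /K0; rewrite invr_gt0 sqrtr_gt0.
have c2 p : p \in A -> c p ^+ 2 = (K p p)^-1.
  by move=> /K0 h; rewrite exprVn sqr_sqrtr // ltW.
pose G := invmx (gram A u w).
(* Since [2 ^+ k i] is the square root of [w i], the sum of [a *m a^T] over [s] is [G], the inverse
   Gram matrix. *)
pose s := [seq 2 ^+ k i *: (G *m (u i)^T) | i <- enum A].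
have kapE p q : \sum_(a <- s) pairing (c p *: u p) a * pairing (c q *: u q) a =
    c p * c q * K p q.
  rewrite big_map big_enum /= /K -lev_mul // mulr_sumr; apply: eq_bigr => i _.
  rewrite !pairingZl !pairingZr !pairing_comp /pairing -!/(lev _ _ _ _ _).
  rewrite /w /pw4 -[4]/(2 * 2)%:R natrM exprMn.
  rewrite -!/(K _ _) /K (lev_sym _ _ _ p) (lev_sym _ _ _ q).
  by rewrite !mulrA; ring.
have [||g hg] := @sign_split R r I A same (fun p => c p *: u p) s psd.
- by move=> p pA; rewrite kapE -expr2 c2 // mulVf // gt_eqF ?K0.
- apply: le_trans hE'.
  rewrite [leRHS](_ : _ = 256 * ((4 * M)%:R ^+ 2 * \sum_(p in A) w p * K p p)).
    rewrite ler_pM2l // mulr_sumr; apply: ler_sum => p pA.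
    rewrite -[K p p]lev_mul // !mulr_sumr; apply: ler_sum => q qA.
    rewrite kapE !exprMn !c2 //.
    have inv j : j \in A -> (K j j)^-1 <= (4 * M)%:R * w j.
      by move=> jA; rewrite -[leLHS]mul1r ler_pdivrMr ?K0 // -mulrA hk.
    rewrite lev_sym -/(K p q) -expr2.
    have -> : (4 * M)%:R ^+ 2 * (w p * (w q * K p q ^+ 2)) =
      ((4 * M)%:R * w p) * ((4 * M)%:R * w q) * K p q ^+ 2 by ring.
    rewrite ler_wpM2r ?sqr_ge0 // ler_pM ?inv ?invr_ge0 // ltW ?K0 //.
  by rewrite lev_trace // !natrM; ring.
exists g; apply: le_trans hg _; rewrite ler_pM2l //.
apply: ler_sum => p pA; apply: ler_sum => q qA.
rewrite ler_nat !pairingZl mulrACA pmulr_rlt0 //.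
by rewrite mulr_gt0 ?c0.
Qed.

Lemma vector_split : (0 < d)%N -> 2 ^+ 15 * #|I|%:R ^+ 2 <= d%:R * E ->
  exists2 g, g != 0 &
    \sum_p \sum_q (same p q && (0 < pairing (v p) g * pairing (v q) g)%R)%:R
      <= 383 / 384 * E.
Proof.
move=> d0 hE.
have E0 : 0 <= E by rewrite sumr_ge0 // => p _; rewrite sumr_ge0.
(* If the vectors do not span, some nonzero [x] annihilates them all and no product is positive. *)
have [rT|rT] := eqVneq (srank v setT) d; last first.
  have : kermx (span setT v)^T != 0.
    rewrite kermx_eq0 /row_free mxrank_tr; exact: rT.
  move=> /rowV0Pn[x /sub_kermxP xk x0]; exists x^T; first by rewrite trmx_eq0.
  rewrite big1 ?mulr_ge0 ?invr_ge0 // => p _; rewrite big1 // => q _.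
  suff -> : pairing (v p) x^T = 0 by rewrite mul0r ltxx andbF.
  have /submxP[D ->] : (v p <= span setT v)%MS by apply: span_sub.
  rewrite /pairing -mulmxA -[span _ _]trmxK -trmx_mul xk trmx0 mulmx0 mxE //.
pose M := (#|I| %/ d).+1.
have IM : (#|I| < M * d)%N by rewrite ltn_ceil.
have [A [r [C [/andP[r0 rd] fC kC sA hM]]]] := dense_quotient IM rT.
have dI : (d <= #|I|)%N by rewrite -rT -cardsT srank_card.
pose E' : R := \sum_(p in A) \sum_(q in A) (same p q)%:R.
have red (g : 'cV[R]_r) : \sum_p \sum_q
     (same p q && (0 < pairing (v p) (C *m g) * pairing (v q) (C *m g))%R)%:R =
   \sum_(p in A) \sum_(q in A) (same p q &&
     (0 < pairing (v p *m C) g * pairing (v q *m C) g)%R)%:R :> R.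
  have z p : p \notin A -> pairing (v p) (C *m g) = 0.
    by move=> pA; rewrite pairing_comp kC // /pairing mul0mx mxE.
  rewrite [RHS]big_mkcond; apply: eq_bigr => p _; case: ifPn => pA.
    rewrite [RHS]big_mkcond; apply: eq_bigr => q _; case: ifPn => qA.
      by rewrite !pairing_comp.
    by rewrite (z q) // mulr0 ltxx andbF.
  by rewrite big1 // => q _; rewrite (z p) // mul0r ltxx andbF.
have E'E : E' <= E.
  rewrite /E' /E big_mkcond; apply: ler_sum => p _; case: ifP => _.
    by rewrite big_mkcond; apply: ler_sum => q _; case: ifP.
  by rewrite sumr_ge0.
have [hE'|hE'] := leP ((2 ^ 12 * M ^ 2 * r)%:R) E'.
  have [g hg] := quotient_split sA hM hE'; exists (C *m g).
    apply/eqP => Cg0; move: hg; apply/negP; rewrite -ltNge.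
    rewrite big1 ?mulr0.
      apply: lt_le_trans hE'; rewrite ltr0n.
      by rewrite muln_gt0 r0 andbT muln_gt0 !expn_gt0.
    move=> p pA; rewrite big1 // => q qA.
    by rewrite -!pairing_comp Cg0 pairing0 mul0r ltxx andbF.
  rewrite red.
  apply: le_trans (_ : E' - \sum_(p in A) \sum_(q in A)
     (same p q && (pairing (v p *m C) g * pairing (v q *m C) g < 0)%R)%:R <= _).
    rewrite /E' -sumrB; apply: ler_sum => p _.
    rewrite -sumrB; apply: ler_sum => q _.
    case: (same p q) => /=; last by rewrite subrr.
    by case: ltgtP => _; rewrite ?subr0 ?subrr.
  by move: hg; rewrite -/E'; lra.
(* From [M * d <= 2 * #|I|] and [r <= d], the failed threshold gives
   [d * E' <= 2 ^+ 14 * #|I| ^+ 2], half of the hypothesis. Any nonzero vector factoring through [C]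
   then suffices, as it kills every pair not inside [A]. *)
have small : E' <= 1 / 2 * E.
  apply: (le_trans (ltW hE')); rewrite -(ler_pM2l (_ : 0 < d%:R)) ?ltr0n //.
  apply: le_trans (_ : 2 ^+ 14 * #|I|%:R ^+ 2 <= _); last by lra.
  rewrite -!natrX -!natrM ler_nat.
  have Md : (M * d <= 2 * #|I|)%N.
    by rewrite /M mulSn mul2n -addnn leq_add // leq_divM.
  have h : (M * M * d * r <= 2 * #|I| * (2 * #|I|))%N.
    apply: leq_trans (leq_mul Md Md).
    by rewrite mulnACA -!mulnA !leq_mul.
  rewrite (_ : d * _ = 2 ^ 12 * (M * M * d * r))%N; last first.
    by move: (2 ^ 12)%N => c; ring.
  apply: leq_trans (leq_mul (leqnn _) h) _; apply: eq_leq.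
  by rewrite (_ : 2 ^ 14 = 2 ^ 12 * 4)%N //; move: (2 ^ 12)%N => c; ring.
pose g := C *m const_mx 1 : 'cV[R]_d; exists g.
  apply/eqP => g0; have /row_fullP [B BC] := fC.
  have : B *m g = 0 by rewrite g0 mulmx0.
  rewrite mulmxA BC mul1mx => /matrixP/(_ (Ordinal r0) 0)/eqP.
  by rewrite !mxE oner_eq0.
rewrite red; apply: le_trans (_ : E' <= _); last by lra.
apply: ler_sum => p _; apply: ler_sum => q _.
by case: (same p q) => //=; case: ltP.
Qed.

End VectorSplit.

(** * Polynomial partitioning *)

Section PolynomialPartition.
Variable R : realType.

Definition ev n (f : mpoly n R) (p : 'rV[R]_n) : R := meval (fun i => p 0 i) f.

Section Box.
Variable e : nat.
Local Notation J := {ffun 'I_3 -> 'I_e}.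
Local Notation d := #|{: J}|.

(** Exponents range over a cube rather than a simplex, so the dimension is exactly [e ^ 3] while the
    degree stays below [3 * e]. *)
Definition boxmon (j : 'I_d) : multinom 3 :=
  Multinom [tuple (enum_val j i : nat) | i < 3].

Definition boxpoly (g : 'cV[R]_d) : mpoly 3 R :=
  \sum_(j < d) g j 0 *: mpolyX R (boxmon j).

Definition boxvec (p : 'rV[R]_3) : 'rV[R]_d :=
  \row_j \prod_(i < 3) p 0 i ^+ boxmon j i.

Lemma ev_boxpoly g p : ev (boxpoly g) p = pairing (boxvec p) g.
Proof.
rewrite /ev /boxpoly raddf_sum /pairing mxE; apply: eq_bigr => j _ /=.
by rewrite mevalZ mevalX mxE mulrC.
Qed.

Lemma boxmon_inj : injective boxmon.
Proof.
move=> j j' /mnmP h; apply: enum_val_inj; apply/ffunP => i; apply: val_inj.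
by have := h i; rewrite !mnmE.
Qed.

Lemma boxpoly_neq0 g : g != 0 -> boxpoly g != 0.
Proof.
apply: contra_neq => h; apply/matrixP => j k; rewrite (ord1 k) mxE.
have := congr1 (mcoeff (boxmon j)) h.
rewrite mcoeff0 /boxpoly raddf_sum (bigD1 j) //= mcoeffZ mcoeffX eqxx mulr1.
rewrite big1 ?addr0 // => j' jj'; rewrite mcoeffZ mcoeffX.
by rewrite (inj_eq boxmon_inj) (negPf jj') mulr0.
Qed.

Lemma msize_boxpoly g : (msize (boxpoly g) <= 3 * e)%N.
Proof.
apply: leq_trans (msize_sum _ _ _) _; apply/bigmax_leqP => j _.
apply: leq_trans (msizeZ_le _ _) _; rewrite msizeX mdegE.
have : (\sum_(i < 3) (1 + boxmon j i) <= 3 * e)%N.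
  have -> : (3 * e = \sum_(i < 3) e)%N by rewrite sum_nat_const card_ord.
  apply: leq_sum => i _.
  by rewrite add1n mnmE.
by rewrite big_split /= sum1_card card_ord; lia.
Qed.

End Box.

Variables (I : finType) (pt : I -> 'rV[R]_3).
Implicit Types (fs : seq (mpoly 3 R)).

(** A point on the zero set of some member of [fs] is not related even to itself, so it contributes
    nothing to [energy]. *)
Definition same_cell fs : rel I :=
  fun p q => all (fun f => 0 < ev f (pt p) * ev f (pt q)) fs.

Definition energy fs : R := \sum_p \sum_q (same_cell fs p q)%:R.

(* [a b > 0] = (sg a sg b + (sg a)^2 (sg b)^2) / 2 is a sum of two kernels of
   rank one. *)
Lemma same_cell_psd fs (y : I -> R) :
  0 <= \sum_p \sum_q (same_cell fs p q)%:R * (y p * y q).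
Proof.
elim: fs y => [|f fs IH] y.
  have -> : \sum_p \sum_q (same_cell [::] p q)%:R * (y p * y q) =
      (\sum_p y p) ^+ 2.
    rewrite expr2 mulr_suml; apply: eq_bigr => p _; rewrite mulr_sumr.
    by apply: eq_bigr => q _; rewrite mul1r.
  exact: sqr_ge0.
pose s p := Num.sg (ev f (pt p)).
have := addr_ge0 (IH (fun p => s p * y p)) (IH (fun p => s p ^+ 2 * y p)).
rewrite -big_split /= => h; rewrite -(pmulr_rge0 _ (ltr0Sn R 1)).
apply: le_trans h _; rewrite mulr_sumr le_eqVlt; apply/orP; left; apply/eqP.
apply: eq_bigr => p _; rewrite -big_split mulr_sumr; apply: eq_bigr => q _ /=.
have -> : (0 < ev f (pt p) * ev f (pt q)) = (s p * s q == 1).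
  by rewrite /s -sgrM sgr_cp0.
rewrite /s; case: (same_cell fs p q);
  rewrite ?andbF ?andbT /= ?mul0r ?addr0 ?mulr0 //.
case: sgrP => _; case: sgrP => _;
  rewrite ?(mul0r, mulr0, mul1r, mulr1, mulrNN, mulN1r, mulrN1);
  rewrite ?(expr0n, expr1n, sqrrN);
  rewrite ?eqxx ?[0 == 1]eq_sym ?oner_eq0 ?mulr0 ?mul0r ?addr0 //=.
all: try (rewrite (_ : (-1 == 1 :> R) = false); last by apply/eqP; lra).
all: rewrite /= ?mul0r ?mulr0 ?mul1r ?mulr1; lra.
Qed.

Lemma energy_ge0 fs : 0 <= energy fs.
Proof. by rewrite sumr_ge0 // => p _; rewrite sumr_ge0. Qed.

Lemma partition_step e fs : (0 < e)%N ->
  2 ^+ 15 * #|I|%:R ^+ 2 <= e%:R ^+ 3 * energy fs ->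
  exists f, [/\ f != 0, (msize f <= 3 * e)%N &
                energy (f :: fs) <= 383 / 384 * energy fs].
Proof.
move=> e0 h.
have cd : #|{: {ffun 'I_3 -> 'I_e}}| = (e ^ 3)%N by rewrite card_ffun !card_ord.
have [||g g0 hg] :=
  @vector_split R I _ (fun p => boxvec e (pt p)) _ (same_cell_psd fs).
- by rewrite cd expn_gt0 e0.
- by rewrite cd natrX.
exists (boxpoly g); split; [exact: boxpoly_neq0 | exact: msize_boxpoly |].
apply: le_trans hg; rewrite le_eqVlt; apply/orP; left; apply/eqP.
by apply: eq_bigr => p _; apply: eq_bigr => q _; rewrite /= !ev_boxpoly andbC.
Qed.

(** Once the energy is too small for another step at scale [e], the target holds and the iteration
    idles; before that, each step gains a constant factor. *)
Lemma partition_iter e fs r : (0 < e)%N ->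
  exists fs', [/\ all (fun f => f != 0) fs',
    (\sum_(f <- fs') msize f <= r * (3 * e))%N &
    e%:R ^+ 3 * energy (fs' ++ fs) <= 2 ^+ 15 * #|I|%:R ^+ 2 \/
    energy (fs' ++ fs) <= (383 / 384) ^+ r * energy fs].
Proof.
move=> e0; elim: r => [|r [fs' [nz sz alt]]].
  by exists [::]; split; rewrite ?big_nil //; right; rewrite mul1r.
have [h|h] := leP (e%:R ^+ 3 * energy (fs' ++ fs)) (2 ^+ 15 * #|I|%:R ^+ 2).
  exists fs'; split=> //; last by left.
  by apply: leq_trans sz _; rewrite leq_mul2r leqnSn orbT.
case: alt => [h'|alt]; first by move: h; rewrite ltNge h'.
have [f [f0 fe hf]] := partition_step e0 (ltW h).
exists (f :: fs'); split; rewrite /= ?f0 ?big_cons //.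
  by rewrite mulSn leq_add.
right; apply: le_trans hf _; rewrite exprS -[leRHS]mulrA ler_wpM2l //.
by rewrite divr_ge0.
Qed.

End PolynomialPartition.

Lemma geometric_decay (R : realType) : exists r, (383 / 384) ^+ r <= 1 / 8 :> R.
Proof.
(* With [x = - (1 / 384)], this exponent makes the Bernoulli factor [1 - M * x] equal to 8. *)
exists (7 * 384)%N; have x1 : -1 <= - (1 / 384) :> R by lra.
have := bernoulli_inv (7 * 384) x1.
rewrite (_ : 1 + - (1 / 384) = 383 / 384); last by lra.
rewrite natrM (_ : 1 - _ = 8); last by lra.
by rewrite ler_pdivlMr.
Qed.

Lemma polynomial_partition (R : realType) : exists C : nat,
  forall (I : finType) (pt : I -> 'rV[R]_3) (k : nat),
  exists fs : seq (mpoly 3 R), [/\ all (fun f => f != 0) fs,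
    (\sum_(f <- fs) msize f <= C * 2 ^ k)%N &
    8 ^+ k * energy pt fs <= 2 ^+ 15 * #|I|%:R ^+ 2].
Proof.
have [r r8] := geometric_decay R; exists (r * 6)%N => I pt.
elim=> [|k [fs [nz sz hE]]].
  exists [::]; split; rewrite ?big_nil // expr0 mul1r.
  have -> : energy pt [::] = #|I|%:R ^+ 2.
    rewrite /energy (eq_bigr (fun=> #|I|%:R)); last first.
      by move=> p _; rewrite /= sumr_const.
    by rewrite sumr_const expr2 mulr_natl.
  by rewrite ler_peMl ?sqr_ge0 // exprn_ege1 // ler1n.
(* Each stage doubles the degree scale and divides the energy by 8 in a fixed number [r] of steps,
   so the degrees sum geometrically: [r * 3 * 2 ^ k.+1] is added to [r * 6 * 2 ^ k]. *)
have [|fs' [nz' sz' alt]] := @partition_iter R I pt (2 ^ k.+1) fs r.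
  by rewrite expn_gt0.
exists (fs' ++ fs); split; first by rewrite all_cat nz'.
  rewrite big_cat /=; apply: leq_trans (leq_add sz' sz) _.
  by rewrite expnS; move: (2 ^ k)%N => x; nia.
case: alt => [h|h].
  by move: h; rewrite natrX exprAC -natrX.
apply: le_trans hE; rewrite exprSr -mulrA ler_wpM2l ?exprn_ge0 //.
have := energy_ge0 pt fs; move: h; have := r8.
move: (energy pt fs) (energy pt (fs' ++ fs)) (_ ^+ r) => x y z; nra.
Qed.

(** * Restriction of polynomials to lines, and partial derivatives *)

Section LineRestriction.
Variables (R : realType) (n : nat) (a b : 'rV[R]_n).
Implicit Types (f g : mpoly n R).

Definition linepoly (i : 'I_n) : {poly R} := (a 0 i)%:P + b 0 i *: 'X.

Definition restrict f : {poly R} := mmap (@polyC R) linepoly f.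

HB.instance Definition _ :=
  GRing.RMorphism.copy restrict (mmap (@polyC R) linepoly).

Lemma restrictZ c f : restrict (c *: f) = c *: restrict f.
Proof. by rewrite /restrict mmapZ mul_polyC. Qed.

Lemma horner_restrict f t : (restrict f).[t] = ev f (a + t *: b).
Proof.
rewrite /restrict /mmap horner_sum /ev mevalE; apply: eq_bigr => m _.
rewrite hornerM hornerC horner_prod; congr (_ * _); apply: eq_bigr => i _.
by rewrite horner_exp !hornerE !mxE [t * _]mulrC.
Qed.

Lemma size_restrict f : (size (restrict f) <= msize f)%N.
Proof.
rewrite /restrict /mmap; apply: leq_trans (size_sum _ _ _) _.
rewrite big_seq; elim/big_ind: _ => // [x y hx hy|m mf].
  by rewrite geq_max hx.
rewrite mul_polyC; apply: leq_trans (size_scale_leq _ _) _.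
apply: leq_trans (msize_mdeg_lt mf); rewrite mdegE /mmap1.
have s2 i : (size (linepoly i) <= 2)%N.
  apply: leq_trans (size_polyD _ _) _; rewrite geq_max.
  rewrite (leq_trans (size_polyC_leq1 _)) //.
  rewrite (leq_trans (size_scale_leq _ _)) //.
  by rewrite size_polyX.
elim/big_ind2: _ => [|p k q l hp hq|i _]; first by rewrite size_poly1.
  by apply: leq_trans (size_polyMleq _ _) _; lia.
apply: leq_trans (size_poly_exp_leq _ _) _.
by have := s2 i; case: (size _) => [|[|[|]]] //= _; rewrite ?mul0n ?mul1n.
Qed.

(** The chain rule: it passes to products, holds for variables, hence for monomials, and extends by
    linearity. *)
Lemma deriv_restrict f :
  (restrict f)^`() = \sum_i b 0 i *: restrict (mderiv i f).
Proof.
pose D f := (restrict f)^`() = \sum_i b 0 i *: restrict (mderiv i f).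
have DM g h : D g -> D h -> D (g * h).
  rewrite /D => hg hh; rewrite rmorphM derivM hg hh mulr_suml mulr_sumr.
  rewrite -big_split; apply: eq_bigr => i _ /=.
  by rewrite mderivM rmorphD !rmorphM scalerDr scalerAl scalerAr.
have D1 : D 1.
  rewrite /D rmorph1 derivC big1 // => i _.
  by rewrite -mpolyC1 mderivC rmorph0 scaler0.
have DX i : D (mpolyX R (mnm1 i)).
  rewrite /D {1}/restrict mmapX mmap1U /linepoly.
  rewrite derivD derivC derivZ derivX add0r.
  rewrite (bigD1 i) //= mderivX mnm1E eqxx scale1r.
  rewrite (_ : mnm_sub _ _ = @mnm0 n); last first.
    by apply/mnmP => j; rewrite mnmBE mnm0E subnn.
  rewrite mpolyX0 rmorph1 alg_polyC big1 ?addr0 -?alg_polyC // => j ji.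
  by rewrite mderivX mnm1E eq_sym (negPf ji) scale0r rmorph0 scaler0.
have Dm m : D (mpolyX R m).
  rewrite mpolyXE_id; elim/big_ind: _ => // i _.
  by elim: (m i) => // k IH; rewrite exprS; apply: DM.
rewrite -/(D f) [f]mpolyE; elim/big_ind: _ => [|g h hg hh|m _].
- by rewrite /D rmorph0 derivC big1 // => i _; rewrite mderiv0 rmorph0 scaler0.
- rewrite /D rmorphD derivD hg hh -big_split; apply: eq_bigr => i _ /=.
  by rewrite mderivD rmorphD scalerDr.
- rewrite /D restrictZ derivZ Dm scaler_sumr; apply: eq_bigr => i _.
  by rewrite mderivZ restrictZ !scalerA mulrC.
Qed.

End LineRestriction.

Lemma msize_mderiv (R : realType) n (f : mpoly n R) i :
  (msize (mderiv i f) <= (msize f).-1)%N.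
Proof.
rewrite msizeE big_seq; elim/big_ind: _ => // [x y hx hy|m].
  by rewrite geq_max hx.
rewrite mcoeff_msupp mcoeff_deriv mulrn_eq0 /= -mcoeff_msupp => /msize_mdeg_lt.
by rewrite mdegD mdeg1 addn1; case: (msize f).
Qed.

Lemma mderiv_eq0_const (R : realType) n (f : mpoly n R) :
  (forall i, mderiv i f = 0) -> (msize f <= 1)%N.
Proof.
move=> h; rewrite msizeE big_seq; elim/big_ind: _ => // [x y hx hy|m mf].
  by rewrite geq_max hx.
rewrite ltnS leqn0 mdeg_eq0; apply/eqP/mnmP => i; rewrite mnm0E.
apply/eqP; rewrite -leqn0 leqNgt; apply/negP => mi.
have := congr1 (mcoeff (mnm_sub m (mnm1 i))) (h i).
rewrite mcoeff_deriv mcoeff0 submK; last first.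
  by apply/mnm_lepP => j; rewrite mnm1E; case: eqP => // <-.
by apply/eqP; rewrite mulrn_eq0 negb_or -mcoeff_msupp mf andbT.
Qed.

(** * Counting incidences on and off a surface *)

(** A nonempty fibre of [h] is counted by one representative plus the collisions of that
    representative with the rest. *)
Lemma card_le_collisions (T : finType) (X : {set T}) N (h : T -> nat) :
  (forall x, x \in X -> (h x <= N)%N) ->
  (#|X| <= N.+1 + \sum_(x in X) \sum_(y in X) ((x != y) && (h x == h y)))%N.
Proof.
move=> hN; pose Xc (c : nat) := [set x in X | h x == c].
have part F : (\sum_(x in X) F x = \sum_(c < N.+1) \sum_(x in Xc c) F x)%N.
  rewrite (partition_big (fun x => inord (h x) : 'I_N.+1) xpredT) //=.
  apply: eq_bigr => c _; apply: eq_bigl => x; rewrite inE.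
  case xX: (x \in X) => //=; rewrite -val_eqE /= inordK ?ltnS ?hN //.
rewrite -sum1_card !part -[X in (_ <= X + _)%N]card_ord -sum1_card -big_split.
apply: leq_sum => c _ /=; rewrite sum1_card.
have [->|/set0Pn[x xX]] := eqVneq (Xc c) set0; first by rewrite cards0.
rewrite (cardsD1 x) xX leq_add2l (big_setD1 x) //=.
apply: leq_trans (leq_addr _ _); move: xX; rewrite inE => /andP[xX /eqP hx].
rewrite (big_setD1 x) //= eqxx add0n -sum1_card.
rewrite big_mkcond [leqRHS]big_mkcond; apply: leq_sum => y _.
rewrite !inE; case: (eqVneq y x) => //= yx; case: (y \in X) => //=.
by rewrite hx [_ == h y]eq_sym; case: (h y == c).
Qed.

Section Incidences.
Variables (R : realType) (I J : finType) (pt : I -> 'rV[R]_3).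
Variables (la lb : J -> 'rV[R]_3) (inc : I -> J -> bool) (b : nat).
Hypothesis pt_inj : injective pt.
Hypothesis incP : forall i j, inc i j -> exists t, pt i = la j + t *: lb j.
Hypothesis inc_uniq : forall i i' j j', i != i' ->
  inc i j -> inc i' j -> inc i j' -> inc i' j' -> j = j'.
(** Linear form of the coplanarity condition: more than [b] concurrent lines cannot have all
    directions in one plane. *)
Hypothesis joint : forall i (S : {set J}), (forall j, j \in S -> inc i j) ->
  (b < #|S|)%N -> (1%:M <= span S lb)%MS.

Local Notation rst j f := (restrict (la j) (lb j) f).

Lemma param : exists t : I -> J -> R,
  forall i j, inc i j -> pt i = la j + t i j *: lb j.
Proof.
have h i j : exists t, inc i j -> pt i = la j + t *: lb j.
  by case: (boolP (inc i j)) => [/incP[t ht]|]; [exists t | exists 0].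
by exists (fun i j => projT1 (cid (h i j))) => i j; case: cid.
Qed.

Lemma card_zeros_line (X : {set I}) j f : rst j f != 0 ->
  (forall i, i \in X -> inc i j /\ ev f (pt i) = 0) -> (#|X| <= msize f)%N.
Proof.
move=> nz hX; have [t ht] := param.
have tinj : {in X &, injective (fun i => t i j)}.
  move=> i i' /hX[ij _] /hX[i'j _] e; apply: pt_inj.
  by rewrite (ht _ _ ij) (ht _ _ i'j) e.
pose rs := [seq t i j | i <- enum X].
have u : uniq rs.
  rewrite map_inj_in_uniq ?enum_uniq // => i i'.
  by rewrite !mem_enum; apply: tinj.
have rt : all (root (rst j f)) rs.
  apply/allP => x /mapP[i]; rewrite mem_enum => /hX[ij fi] ->.
  by rewrite rootE horner_restrict -(ht _ _ ij) fi.
have := max_poly_roots nz rt u; rewrite size_map -cardE => lt.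
by apply: leq_trans (ltnW lt) (size_restrict _ _ _).
Qed.

(* If no point has few lines and no line has few points, then every
   polynomial of degree below D vanishing on the lines has a gradient
   vanishing at all the points, hence on all the lines; descending on the
   degree gives a nonzero constant vanishing on a line. *)
Lemma no_rich_configuration (A : {set I}) (B : {set J}) D f :
  (forall i, i \in A -> (b < #|[set j in B | inc i j]|)%N) ->
  (forall j, j \in B -> (D < #|[set i in A | inc i j]|)%N) ->
  B != set0 -> f != 0 -> (msize f <= D)%N ->
  ~ (forall j, j \in B -> rst j f = 0).
Proof.
move=> hA hB /set0Pn[j0 j0B].
move: {2}(msize f) (leqnn (msize f)) => N; elim: N f => [|N IH] f fN f0 fD fB.
  by move: fN; rewrite leqn0 msize_poly_eq0 (negPf f0).
have [t ht] := param.
have grad i k : i \in A -> ev (mderiv k f) (pt i) = 0.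
  move=> iA; pose S := [set j in B | inc i j].
  have sS : (1%:M <= span S lb)%MS.
    by apply: (@joint i) (hA i iA) => j; rewrite inE => /andP[].
  (* The derivative of the zero restriction at [pt i] is the gradient [v] paired with the direction
     of the line; these directions span, so [v] vanishes. *)
  pose v : 'rV[R]_3 := \row_l ev (mderiv l f) (pt i).
  have : (1%:M <= kermx v^T)%MS.
    apply: submx_trans sS _; apply: spanP => j; rewrite inE => /andP[jB ij].
    apply/sub_kermxP/matrixP => x y; rewrite !ord1 !mxE.
    have := congr1 (fun p => p^`().[t i j]) (fB j jB).
    rewrite /= deriv_restrict deriv0 horner0 horner_sum => e0.
    rewrite -[RHS]e0; apply: eq_bigr => l _.
    by rewrite hornerZ horner_restrict -(ht _ _ ij) !mxE.
  move/sub_kermxP; rewrite mul1mx => /matrixP/(_ k 0).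
  by rewrite !mxE.
have vanish k j : j \in B -> rst j (mderiv k f) = 0.
  move=> jB; apply/eqP/negPn/negP => nz.
  have := @card_zeros_line [set i in A | inc i j] j (mderiv k f) nz.
  move=> /(_ _)/(leq_trans (hB j jB)) h.
  have : (D < msize (mderiv k f))%N.
    by apply: h => i; rewrite inE => /andP[/grad].
  have := msize_mderiv f k; have := fD.
  by case: (msize f) => [|m] /= mD m1 m2; lia.
have dz k : mderiv k f = 0.
  apply/eqP/negPn/negP => nz; apply: (IH (mderiv k f)) => //.
  - apply: leq_trans (msize_mderiv f k) _.
    by move: fN; case: (msize f).
  - apply: leq_trans (msize_mderiv f k) (leq_trans (leq_pred _) fD).
  - by move=> j; apply: vanish.
have := fB j0 j0B; have := msize1_polyC (mderiv_eq0_const dz) => fc.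
rewrite fc /restrict mmapC => /eqP; rewrite polyC_eq0 => /eqP c0.
by move: f0; rewrite fc c0 mpolyC0 eqxx.
Qed.

(** Deleting a point with at most [b] lines, or a line with at most [msize f] points, is paid for by
    the bound. When neither exists, [no_rich_configuration] leaves no line. *)
Lemma incidences_in_surface f (A : {set I}) (B : {set J}) : f != 0 ->
  (forall j, j \in B -> rst j f = 0) ->
  (\sum_(i in A) \sum_(j in B) inc i j <= b * #|A| + msize f * #|B|)%N.
Proof.
move=> f0; move: {2}(#|A| + #|B|)%N (leqnn (#|A| + #|B|)) => N.
elim: N A B => [|N IH] A B cN fB.
  have A0 : A = set0 by apply: cards0_eq; lia.
  by rewrite A0 big_set0.
have [/exists_inP[i iA di]|/exists_inPn hA] :=
    boolP [exists i in A, (#|[set j in B | inc i j]| <= b)%N].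
  have cA : #|A| = #|A :\ i|.+1 by rewrite (cardsD1 i A) iA.
  rewrite (big_setD1 i) //= cA mulnS -addnA leq_add //.
    by rewrite -big_mkcondr /= sum1dep_card.
  by apply: IH fB; lia.
have [/exists_inP[j jB dj]|/exists_inPn hB] :=
    boolP [exists j in B, (#|[set i in A | inc i j]| <= msize f)%N].
  have cB : #|B| = #|B :\ j|.+1 by rewrite (cardsD1 j B) jB.
  rewrite exchange_big (big_setD1 j) //= cB mulnS addnCA leq_add //.
    by rewrite -big_mkcondr /= sum1dep_card.
  rewrite exchange_big; apply: IH; first by lia.
  by move=> j'; rewrite inE => /andP[_ /fB].
have [B0|B0] := eqVneq B set0.
  by rewrite big1 // => i _; rewrite B0 big_set0.
exfalso; apply: (@no_rich_configuration A B (msize f) f) => //.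
  by move=> i iA; rewrite ltnNge hA.
by move=> j jB; rewrite ltnNge hB.
Qed.

Lemma all_neq0_prod (fs : seq (mpoly 3 R)) :
  all (fun f => f != 0) fs -> \prod_(f <- fs) f != 0.
Proof. by move=> /allP h; rewrite prodf_seq_neq0; apply/allP => f /h ->. Qed.

Lemma msize_prod (fs : seq (mpoly 3 R)) : all (fun f => f != 0) fs ->
  (msize (\prod_(f <- fs) f) <= (\sum_(f <- fs) msize f).+1)%N.
Proof.
elim: fs => [_|f fs IH /= /andP[f0 nz]]; first by rewrite !big_nil msize1.
rewrite !big_cons msizeM // ?all_neq0_prod //.
by apply: leq_trans (leq_pred _) _; rewrite -addnS leq_add2l IH.
Qed.

Lemma restrict_prod j (fs : seq (mpoly 3 R)) :
  rst j (\prod_(f <- fs) f) = \prod_(f <- fs) rst j f.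
Proof. exact: rmorph_prod. Qed.

Definition off_surface (fs : seq (mpoly 3 R)) i :=
  all (fun f => ev f (pt i) != 0) fs.

(* The number of roots of the product below a point determines its cell. *)
Lemma card_line_cells fs j (X : {set I}) :
  (forall i, i \in X -> inc i j /\ off_surface fs i) ->
  all (fun f => f != 0) fs ->
  (#|X| <= (\sum_(f <- fs) msize f).+2 +
     \sum_(p in X) \sum_(q in X) ((p != q) && same_cell pt fs p q))%N.
Proof.
move=> hX nz; have [t ht] := param.
have [->|/set0Pn[i0 i0X]] := eqVneq X set0; first by rewrite cards0.
pose g := rst j (\prod_(f <- fs) f).
have gE i : i \in X -> ~~ root g (t i j).
  move=> /hX[ij /allP off]; rewrite rootE /g restrict_prod horner_prod.
  rewrite prodf_seq_neq0; apply/allP => f ff /=.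
  by rewrite horner_restrict -(ht _ _ ij) off.
have g0 : g != 0 by apply: contraNneq (gE _ i0X) => ->; rewrite root0.
pose rs := rootsR g.
have rsP x : (x \in rs) = root g x.
  by rewrite -(roots_on_rootsR g0) in_itv.
have srs : (size rs <= (\sum_(f <- fs) msize f).+1)%N.
  have : (size rs < size g)%N.
    apply: max_poly_roots g0 _ _; first by apply/allP => x; rewrite rsP.
    by apply: lt_sorted_uniq; apply: sorted_roots.
  move=> /ltnW /leq_trans; apply; apply: leq_trans (size_restrict _ _ _) _.
  exact: msize_prod.
pose h i := count (fun x => x < t i j) rs.
(* With [N] the sum of the sizes, root counts range over [0, ..., N.+1], which is [N.+2] values. *)
apply: leq_trans (@card_le_collisions _ X (\sum_(f <- fs) msize f).+1 h _) _.
  by move=> i _; apply: leq_trans (count_size _ _) srs.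
rewrite leq_add2l; apply: leq_sum => p pX; apply: leq_sum => q qX.
case: (p != q) => //=; case: eqP => // hpq.
suff -> : same_cell pt fs p q by [].
wlog le_pq : p q pX qX hpq / t p j <= t q j => [wl|].
  have [le|/ltW le] := leP (t p j) (t q j); first exact: wl.
  have := wl _ _ qX pX (esym hpq) le.
  by rewrite /same_cell; under eq_all do rewrite mulrC.
apply/allP => f ff; rewrite ltNge; apply/negP => neg.
have [pj _] := hX _ pX; have [qj _] := hX _ qX.
(* A sign change of [f] between the two parameters produces a root [x] of [g] counted by [h q] but
   not by [h p]. *)
have [|x] := @polyrcf.poly_ivt R (rst j f) (t p j) (t q j) le_pq.
  by rewrite !horner_restrict -(ht _ _ pj) -(ht _ _ qj).
rewrite in_itv /= => /andP[px xq] rx.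
have gx : root g x.
  rewrite /g restrict_prod rootE horner_prod prodf_seq_eq0.
  by apply/hasP; exists f.
have {}xq : x < t q j.
  by rewrite lt_neqAle xq andbT; apply: contraTneq gx => ->; apply: gE.
have : (h p < h q)%N.
  have : (count (predU (fun y => (y < t p j)%R) (pred1 x)) rs <= h q)%N.
    apply: sub_count => y /orP[|/eqP ->] //=.
    by move=> /lt_le_trans; apply.
  have := count_predUI (fun y => y < t p j) (pred1 x) rs.
  rewrite [X in (_ + X)%N](_ : _ = 0%N).
    rewrite addn0 => ->; apply: leq_trans.
    by rewrite -addn1 leq_add2l -has_count has_pred1 rsP.
  apply/eqP; rewrite -leqn0 leqNgt -has_count; apply/hasPn => y _.
  by apply/negP => /andP[/= yp /eqP yx]; move: yp; rewrite yx ltNge px.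
by rewrite hpq ltnn.
Qed.

(** Points off the surface, lines inside it, and surface points on other lines each cost [N.+2] per
    line. Only the first adds the energy, only the second adds [b * #|I|]. *)
Lemma incidence_bound fs : all (fun f => f != 0) fs ->
  (\sum_i \sum_j inc i j)%N%:R <=
    (b * #|I| + 3 * ((\sum_(f <- fs) msize f).+2 * #|J|))%N%:R + energy pt fs.
Proof.
set N := (\sum_(f <- fs) msize f)%N => nz.
pose F := \prod_(f <- fs) f; have F0 : F != 0 by apply: all_neq0_prod.
have FN : (msize F <= N.+2)%N by apply: leq_trans (msize_prod nz) _.
pose off := [set i | off_surface fs i].
have dead i : i \notin off -> ev F (pt i) = 0.
  rewrite inE => /allPn[f ff /negPn/eqP fi]; apply/eqP.
  rewrite /F /ev rmorph_prod prodf_seq_eq0; apply/hasP; exists f => //=.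
  by apply/eqP.
pose B := [set j | rst j F == 0].
have split : (\sum_i \sum_j inc i j = \sum_(i in off) \sum_j inc i j +
   (\sum_(i in ~: off) \sum_(j in B) inc i j +
    \sum_(i in ~: off) \sum_(j in ~: B) inc i j))%N.
  rewrite (bigID (mem off)) /=; congr addn; rewrite -big_split /=.
  apply: eq_big => [i|i _]; first by rewrite in_setC.
  rewrite (bigID (mem B)) /=; congr addn.
  by apply: eq_bigl => j; rewrite in_setC.
have p2 : (\sum_(i in ~: off) \sum_(j in B) inc i j <=
    b * #|I| + N.+2 * #|J|)%N.
  apply: leq_trans (incidences_in_surface (~: off) F0 _) _.
    by move=> j; rewrite inE => /eqP.
  by rewrite leq_add // leq_mul // max_card.
have p3 : (\sum_(i in ~: off) \sum_(j in ~: B) inc i j <= N.+2 * #|J|)%N.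
  rewrite exchange_big; apply: leq_trans (_ : \sum_(j in ~: B) N.+2 <= _)%N.
    apply: leq_sum => j; rewrite !inE => jB.
    rewrite -big_mkcondr /= sum1dep_card; apply: leq_trans FN.
    by apply: (@card_zeros_line _ j) => // i; rewrite inE inE => /andP[/dead].
  by rewrite sum_nat_const mulnC leq_mul // max_card.
have p1 : (\sum_(i in off) \sum_j inc i j <= N.+2 * #|J| +
    \sum_p \sum_q same_cell pt fs p q)%N.
  pose X j := [set i in off | inc i j].
  rewrite exchange_big /=.
  apply: leq_trans (_ : \sum_j (N.+2 + \sum_(p in X j) \sum_(q in X j)
      ((p != q) && same_cell pt fs p q)) <= _)%N.
    apply: leq_sum => j _; rewrite -big_mkcondr /= sum1dep_card.
    apply: (@card_line_cells fs j) => // i; rewrite inE => /andP[ioff ij].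
    by split=> //; move: ioff; rewrite inE.
  rewrite big_split /= sum_nat_const mulnC leq_add2l.
  rewrite (eq_bigr (fun j => \sum_p \sum_q ((p \in X j) && (q \in X j) &&
      ((p != q) && same_cell pt fs p q)))%N); last first.
    move=> j _; rewrite big_mkcond; apply: eq_bigr => p _.
    case: (p \in X j); last by rewrite big1.
    by rewrite big_mkcond; apply: eq_bigr => q _; case: (q \in X j).
  (* With the sum over lines innermost, a pair of distinct points is counted at most once, because
     at most one line contains both. *)
  rewrite exchange_big; apply: leq_sum => p _.
  rewrite exchange_big; apply: leq_sum => q _ /=.
  case: (same_cell pt fs p q); last by rewrite big1 // => j _; rewrite !andbF.
  have [pq|pq] := eqVneq p q; first by rewrite big1 // => j _; rewrite andbF.
  have [/existsP[j /andP[pj qj]]|/existsPn none] :=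
      boolP [exists j, (p \in X j) && (q \in X j)]; last first.
    by rewrite big1 // => j _; rewrite (negPf (none j)).
  rewrite (bigD1 j) //= pj qj big1 // => j' j'j.
  move: pj qj; rewrite !inE => /andP[_ pj] /andP[_ qj].
  case pj' : (inc p j'); case qj' : (inc q j'); rewrite ?andbF //.
  by move: j'j; rewrite (inc_uniq pq pj qj pj' qj') eqxx.
have -> : energy pt fs = (\sum_p \sum_q same_cell pt fs p q)%N%:R.
  by rewrite natr_sum; apply: eq_bigr => p _; rewrite natr_sum.
rewrite -natrD ler_nat split.
apply: leq_trans (leq_add p1 (leq_add p2 p3)) _.
by move: (N.+2 * #|J|)%N (b * #|I|)%N (\sum_p _)%N => x y z; lia.
Qed.

End Incidences.

(** * The choice of the degree *)

(** Balancing [2 ^+ k * n] against [m ^+ 2 / 8 ^+ k] asks for [16 ^+ k] close to [m ^+ 2 / n].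
    Truncating the logarithm costs the factor 16. *)
Lemma optimize_degree (R : realType) (m n : nat) (b K1 K2 x : R) :
  0 <= b -> 0 <= K1 -> 0 <= K2 ->
  (forall k, exists2 y, x <= b * m%:R + K1 * 2 ^+ k * n%:R + y &
                        8 ^+ k * y <= K2 * m%:R ^+ 2) ->
  x <= (b + K1 + 16 * K2) *
       (m%:R `^ (1 / 2) * n%:R `^ (3 / 4) + m%:R + n%:R).
Proof.
move=> b0 K10 K20 hx; set X := _ `^ _ * _.
have X0 : 0 <= X by rewrite mulr_ge0 ?powR_ge0.
have m0 : 0 <= m%:R :> R by [].
have n0 : 0 <= n%:R :> R by [].
suff [k [z [xz Xz mz]]] : exists k z, [/\ 2 ^+ k * n%:R <= z,
    z <= X + n%:R & m%:R ^+ 2 <= 8 ^+ k * (16 * (z + m%:R))].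
  have [y xy yk] := hx k.
  have yz : y <= 16 * K2 * (z + m%:R).
    rewrite -(ler_pM2l (_ : 0 < 8 ^+ k)) ?exprn_gt0 //; apply: le_trans yk _.
    apply: le_trans (ler_wpM2l K20 mz) _; rewrite le_eqVlt; apply/orP; left.
    by apply/eqP; ring.
  have h1 := ler_wpM2l K10 xz; rewrite mulrA in h1.
  have h2 := ler_wpM2l K10 Xz; have h3 := ler_wpM2l K20 Xz.
  have h4 : 0 <= K2 * m%:R by rewrite mulr_ge0.
  have h5 : 0 <= b * (X + n%:R) by rewrite mulr_ge0 ?addr_ge0.
  have h6 : 0 <= K1 * m%:R by rewrite mulr_ge0.
  lra.
have [mn|mn] := ltnP (m ^ 2) n.
  exists 0%N, n%:R; split; rewrite ?expr0 ?mul1r ?lerDr //.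
  have : (m ^ 2)%:R <= n%:R :> R by rewrite ler_nat ltnW.
  by rewrite natrX; lra.
have [n00|n_gt0] := posnP n.
  (* Without lines any large [k] works; [k = m] does because [m <= 8 ^+ m]. *)
  exists m, 0; rewrite n00 mulr0; split=> //; first by rewrite addr0.
  rewrite add0r.
  have : m%:R <= 8 ^+ m :> R by rewrite -natrX ler_nat ltnW // ltn_expl.
  move: (8 ^+ m) => E hE; have := ler_wpM2l m0 hE; rewrite -expr2.
  have : 0 <= E * m%:R by rewrite mulr_ge0 // (le_trans m0).
  lra.
pose k := trunc_log 16 (m ^ 2 %/ n).
have q0 : (0 < m ^ 2 %/ n)%N by rewrite divn_gt0.
have /andP[lo hi] := trunc_log_bounds (isT : 1 < 16)%N q0.
rewrite -/k leq_divRL // in lo; rewrite -/k ltn_divLR // in hi.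
exists k, (2 ^+ k * n%:R); split=> //.
  (* Fourth powers remove the real exponents: the claim becomes
     [16 ^ k * n ^ 4 <= m ^ 2 * n ^ 3]. *)
  rewrite -[leLHS]addr0 lerD // -(@ler_pXn2r _ 4) //;
    rewrite ?nnegrE ?mulr_ge0 ?exprn_ge0 ?powR_ge0 //.
  have -> : X ^+ 4 = m%:R ^+ 2 * n%:R ^+ 3.
    rewrite /X exprMn -!powR_mulrn ?powR_ge0 // -!powRrM.
    by congr (_ `^ _ * _ `^ _); lra.
  rewrite exprMn -exprM mulnC exprM -!natrX -!natrM ler_nat.
  by rewrite [(n ^ 4)%N]expnS mulnA leq_mul2r lo orbT.
have h : m%:R ^+ 2 <= 16 ^+ k.+1 * n%:R :> R.
  by rewrite -!natrX -natrM ler_nat ltnW.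
apply: le_trans h _; rewrite exprS (_ : 16 = 8 * 2); last by lra.
rewrite exprMn.
have : 0 <= 8 ^+ k * (16 * m%:R) :> R by rewrite !mulr_ge0 ?exprn_ge0.
move: (8 ^+ k) (2 ^+ k) => u v; lra.
Qed.

(** * Lines and planes in space, and the assembly *)

Section Geometry.
Variable R : realType.
Local Open Scope classical_set_scope.

Definition pline (a b : 'rV[R]_3) : set 'rV[R]_3 :=
  [set a + t *: b | t in [set: R]].

Lemma is_lineP (l : set 'rV[R]_3) : is_line l -> exists a b, l = pline a b.
Proof.
move=> [a [b [_ ->]]]; exists a, b.
apply/seteqP; split=> [_ [x _ <-]|_ [t _ <-]].
  by exists (x 0 0) => //; rewrite [x in RHS]mx11_scalar mul_scalar_mx.
by exists t%:M => //; rewrite mul_scalar_mx.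
Qed.

(** The right-hand side depends only on the two points, so two lines sharing them coincide. *)
Lemma pline_two_points a b (p q : 'rV[R]_3) : p != q ->
  pline a b p -> pline a b q -> pline a b = pline p (q - p).
Proof.
move=> pq [t _ tp] [s _ sq].
have st : s - t != 0.
  apply: contra_neq pq => /eqP; rewrite subr_eq0 => /eqP e.
  by rewrite -tp -sq e.
have e : q - p = (s - t) *: b.
  by rewrite -tp -sq opprD addrACA subrr add0r scalerBl.
apply/seteqP; split=> [_ [u _ <-]|_ [u _ <-]].
  exists ((u - t) / (s - t)) => //.
  by rewrite e scalerA divfK // -tp scalerBl -addrA [t *: b + _]addrC subrK.
exists (t + u * (s - t)) => //.
by rewrite e scalerA -tp scalerDl addrA.
Qed.

(** Directions that do not span are orthogonal to some [u != 0]. The complement of [u] has dimension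
    exactly 2, even when the directions span less. *)
Lemma plane_of_directions (I : finType) (S : {set I}) (d : I -> 'rV[R]_3) :
  ~~ (1%:M <= span S d)%MS ->
  exists2 A : 'M[R]_(2, 3), row_free A & forall i, i \in S -> (d i <= A)%MS.
Proof.
rewrite sub1mx => nf.
have : kermx (span S d)^T != 0 by rewrite kermx_eq0 /row_free mxrank_tr.
move=> /rowV0Pn[u /sub_kermxP uk u0].
(* Packing [A] under the existential lets its row dimension be rewritten to 2. *)
have : exists2 A : 'M[R]_(\rank (kermx u^T), 3),
    row_free A & (kermx u^T <= A)%MS.
  by exists (row_base (kermx u^T)); rewrite ?row_base_free // eq_row_base.
have -> : \rank (kermx u^T) = 2%N.
  by rewrite mxrank_ker mxrank_tr rank_rV u0.
move=> [A fA kA]; exists A => // i iS; apply: submx_trans kA.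
apply/sub_kermxP; have /submxP[D ->] := span_sub d iS.
by rewrite -mulmxA -[span _ _]trmxK -trmx_mul uk trmx0 mulmx0.
Qed.

End Geometry.

Lemma incidences_le_sum (R : realType) (n : nat) (P : {fset 'rV[R]_n})
    (L : {fset set 'rV[R]_n}) :
  (incidences P L <= \sum_(i : P) \sum_(j : L) (val i \in val j))%N.
Proof.
rewrite pair_big /= -big_mkcond /= sum1_card.
pose f (ij : P * L) := (val ij.1, val ij.2).
rewrite cardE -(size_map f); apply: uniq_leq_size (fset_uniq _) _ => -[p l] h.
have : (p, l) \in [fset pl in (P `*` L)%fset | pl.1 \in pl.2]%fset := h.
rewrite !finmap.inE /= => /andP[/andP[pP lL] pl].
by apply/mapP; exists ([` pP], [` lL])%fset; rewrite // mem_enum.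
Qed.

Local Open Scope classical_set_scope.

Theorem theorem3p2 (R : realType) (b : nat) :
  exists C : R,
    forall (P : {fset 'rV[R]_3}) (L : {fset set 'rV[R]_3}),
      (forall l : set 'rV[R]_3, l \in L -> is_line l) ->
      (forall (p : 'rV[R]_3) (pi : set 'rV[R]_3),
          p \in P -> is_plane pi -> pi p ->
          (#|` lines_through_in L p pi| <= b)%N) ->
      (incidences P L)%:R <=
        C * (#|` P|%:R `^ (1 / 2) * #|` L|%:R `^ (3 / 4)
             + #|` P|%:R + #|` L|%:R).
Proof.
have [C hC] := polynomial_partition R.
(* The middle term is the factor 3 of [incidence_bound] times [C + 2], from
   [(C * 2 ^ k).+2 <= (C + 2) * 2 ^ k]; the last is the truncation factor 16 times the energy
   constant. *)
exists (b%:R + (3 * (C + 2))%:R + 16 * 2 ^+ 15) => P L lines planes.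
have ab (j : L) : {ab : 'rV[R]_3 * 'rV[R]_3 | val j = pline ab.1 ab.2}.
  by apply: cid; have [a [d ->]] := is_lineP (lines _ (valP j)); exists (a, d).
pose la (j : L) := (projT1 (ab j)).1; pose lb (j : L) := (projT1 (ab j)).2.
have jE (j : L) : val j = pline (la j) (lb j) by rewrite /la /lb; case: (ab j).
pose inc (i : P) (j : L) := val i \in val j.
have incP i j : inc i j -> exists t, val i = la j + t *: lb j.
  by rewrite /inc in_setE jE => -[t _ <-]; exists t.
have uniq i i' j j' : i != i' ->
    inc i j -> inc i' j -> inc i j' -> inc i' j' -> j = j'.
  rewrite /inc !in_setE !jE => ii' ij i'j ij' i'j'; apply: val_inj; rewrite !jE.
  have ne : val i != val i' by rewrite (inj_eq val_inj).
  by rewrite (pline_two_points ne ij i'j) (pline_two_points ne ij' i'j').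
(* If the directions did not span, all lines of [S] would lie in one plane through the point, so
   [planes] would give [#|S| <= b]. *)
have joint i (S : {set L}) : (forall j, j \in S -> inc i j) ->
    (b < #|S|)%N -> (1%:M <= span S lb)%MS.
  move=> Si; apply: contraTT => /plane_of_directions[A fA SA]; rewrite -leqNgt.
  pose pi : set 'rV[R]_3 := [set val i + x *m A | x in [set: 'rV[R]_2]].
  have pl : is_plane pi by exists (val i), A.
  have pii : pi (val i) by exists 0 => //; rewrite mul0mx addr0.
  apply: leq_trans (planes _ _ (valP i) pl pii).
  rewrite cardE -(size_map val); apply: uniq_leq_size => [|l /mapP[j]].
    by rewrite map_inj_uniq ?enum_uniq //; apply: val_inj.
  rewrite mem_enum => jS ->.
  suff : val j \in lines_through_in L (val i) pi by [].
  rewrite !finmap.inE /= (valP j) /=; apply/asboolP; have ij := Si j jS.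
  split; first by move: ij; rewrite /inc in_setE.
  have [t it] := incP _ _ ij; have /submxP[y yE] := SA j jS.
  rewrite jE => _ [s _ <-]; exists ((s - t) *: y) => //.
  by rewrite -scalemxAl -yE it -addrA -scalerDl [t + (s - t)]addrC subrK.
apply: optimize_degree => [||| k]; rewrite ?exprn_ge0 //.
have [fs [nz sz en]] := hC _ (fun i : P => val i) k.
exists (energy (fun i : P => val i) fs); last by rewrite cardfE.
apply: le_trans (_ : (\sum_(i : P) \sum_(j : L) inc i j)%N%:R <= _).
  by rewrite ler_nat incidences_le_sum.
apply: le_trans (incidence_bound val_inj incP uniq joint nz) _.
rewrite lerD2r -!cardfE -natrM -natrX -!natrM -natrD ler_nat leq_add2l.
rewrite mulnA leq_mul2r; apply/orP; right; rewrite -mulnA leq_mul2l /=.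
apply: leq_trans (_ : (C * 2 ^ k).+2 <= _)%N; first by rewrite !ltnS.
rewrite mulnDl -addn2 leq_add2l leq_pmulr //.
by rewrite expn_gt0.
Qed.
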